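(* Let $k$ and $\ell$ be natural numbers, and let $S_n$ denote the symmetric group on $n$ letters. There exists an integer $N$ such that for all $n\ge N$ there are $k$ pairwise disjoint sets of $\ell$ irreducible ordinary (complex) characters of $S_n$, each set consisting of characters with the same degree, and such that characters in distinct sets have different degrees. In other words, as $n$ tends to infinity, the (maximal) number of such disjoint sets of $\ell$ irreducible ordinary characters of $S_n$, all $\ell$ of which have the same degree, also tends to infinity.
   Context: Natural numbers are positive integers. The degree of a character $\chi$ is $\chi(1)$. *)

(* Defs.v *)
From mathcomp Require Import all_boot all_order all_algebra all_fingroup.
From mathcomp Require Import all_solvable all_field all_character.

Set Implicit Arguments.
Unset Strict Implicit.
Unset Printing Implicit Defensive.

Local Open Scope ring_scope.

(* Characters in MathComp take values in algC. Every complex irreducible      *)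
(* character of a finite group is afforded by a representation over the       *)
(* algebraic numbers, so these are exactly the ordinary ones. A set of        *)
(* irreducible characters of G is given by the set of their indices in        *)
(* Iirr G, since i |-> 'chi_i is a bijection from Iirr G onto irr G.          *)

Definition equidegree_family (gT : finGroupType) (G : {group gT}) (k l : nat)
    (A : {ffun 'I_k -> {set Iirr G}}) : bool :=
  [&& [forall i, #|A i| == l],
      [forall i, forall j, (i != j) ==> [disjoint A i & A j]],
      [forall i, forall s in A i, forall t in A i,
         'chi[G]_s 1%g == 'chi[G]_t 1%g]
    & [forall i, forall j, (i != j) ==>
         [forall s in A i, forall t in A j,
            'chi[G]_s 1%g != 'chi[G]_t 1%g]]].

(* The bound k <= Nirr G loses nothing when 0 < l, because the k sets are     *)
(* then nonempty and pairwise disjoint; for l = 0 there is no maximum.        *)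
Definition max_equidegree (gT : finGroupType) (G : {group gT}) (l : nat) : nat :=
  \max_(k < (Nirr G).+1
        | [exists A : {ffun 'I_k -> {set Iirr G}}, equidegree_family l A]) k.

(* Main.v *)
Require Import Defs.
From mathcomp Require Import all_boot all_order all_algebra all_fingroup.
From mathcomp Require Import all_solvable all_field all_character.
From mathcomp Require Import zify ring lra.

(* An irreducible character of S_n is encoded by its set X of beta-numbers    *)
(* (first-column hook lengths); its degree is n! times the product of the     *)
(* differences of X divided by the product of the factorials. This follows    *)
(* from the Jacobi-Trudi virtual characters built from permutation characters *)
(* on words, whose orthonormality reduces to a count of contingency tables    *)
(* that satisfies the same recursion as a determinant of Kronecker deltas.    *)
(*                                                                            *)
(* Centre the beta-numbers at m - 1/2 and let W be a set of half-integers w   *)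
(* such that w and -w are both in X or both out of X; on all other pairs      *)
(* {v, -v} exactly one element is in X. If U is the set of w in W with w, -w  *)
(* in X and #|W| = 2 #|U|, then n does not depend on U, and the degree is a   *)
(* constant divided by the product of |u^2 - v^2|, u in U, v in W \ U.        *)
(*                                                                            *)
(* For W = {3^(e+1)/2}, |u^2 - v^2| is a product of a factor in u, a factor   *)
(* in v and a function of the difference of exponents. Hence two splittings   *)
(* of W into halves with the same autocorrelation give the same degree. A     *)
(* +1/-1 sequence that is a Kronecker product keeps its autocorrelation when  *)
(* one of its factors is reversed, which gives l splittings; changing another *)
(* factor changes the sum of the exponent differences over the cut, hence the *)
(* 3-adic valuation of the degree, which gives k classes. One or two          *)
(* symmetric hooks outside W, which do not interact with the splitting,       *)
(* adjust n to any large value.                                               *)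

Set Implicit Arguments.
Unset Strict Implicit.
Unset Printing Implicit Defensive.

Import Order.TTheory GRing.Theory Num.Theory.
Local Open Scope ring_scope.

(** * Determinants of Kronecker deltas *)

(** By [jt_formE] the alternating sums [jt_char] of permutation characters have Kronecker
    determinants as inner products ([jt_char_dot]). For distinct beta-numbers each is therefore plus
    or minus an irreducible character, whose degree at 1 comes from a Vandermonde determinant
    ([jt_char1]).

    For the diagrams attached to halves U of a fixed W, every factor of the degree cancels or is
    constant except the gaps between U and the rest of W, so degree times [cut] does not depend on U
    ([diagram_index_degree]). What remains is to find many halves with equal products of gaps, in
    many classes.

    When W consists of halved powers of 3, a gap depends only on the difference of exponents, up to
    factors whose product over the cut of a balanced splitting is always the same. Then
    [cut_square_digit] yields l halves with one product, [cut_square_inj] separates k such products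
    by 3-adic valuation, and [equidegree_exists] turns this into the required family for all large
    n. *)

Lemma prod_bool (R : comNzRingType) (I : finType) (P : pred I) :
  \prod_i ((P i)%:R : R) = [forall i, P i]%:R.
Proof.
case: (boolP [forall i, P i]) => [/forallP hP|].
  by rewrite big1 // => i _; rewrite hP.
by rewrite negb_forall => /existsP[i hi]; rewrite (bigD1 i) //= (negPf hi) mul0r.
Qed.

Lemma det_neq0_perm (R : comNzRingType) (m : nat) (M : 'M[R]_m) :
  \det M != 0 -> exists s : 'S_m, forall i, M i (s i) != 0.
Proof.
move=> nz; have /existsP[s /forallP hs] : [exists s : 'S_m, [forall i, M i (s i) != 0]].
  apply: contraR nz; rewrite negb_exists => /forallP h.
  apply/eqP; apply: big1 => s _; have := h s; rewrite negb_forall => /existsP[i].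
  by rewrite negbK => /eqP Mi0; rewrite (bigD1 i) //= Mi0 mul0r mulr0.
by exists s.
Qed.

Section Alternants.
Variable m : nat.
Implicit Types (l k al : 'I_m -> nat) (a b : 'I_m).

Definition delta_det l k : int := \det (\matrix_(i, j) (l i == k j)%:R).

(* The coefficient of x^l in x^al times the alternant det (x_i ^ j). *)
Definition jt_sign l al : int := \det (\matrix_(i, j < m) (al i + j == l i)%N%:R).

Lemma delta_det_ext l1 l2 k1 k2 : l1 =1 l2 -> k1 =1 k2 -> delta_det l1 k1 = delta_det l2 k2.
Proof. by move=> h1 h2; congr (\det _); apply/matrixP=> i j; rewrite !mxE h1 h2. Qed.

Lemma jt_sign_ext l1 l2 al1 al2 : l1 =1 l2 -> al1 =1 al2 -> jt_sign l1 al1 = jt_sign l2 al2.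
Proof. by move=> h1 h2; congr (\det _); apply/matrixP=> i j; rewrite !mxE h1 h2. Qed.

Lemma delta_detE l k :
  delta_det l k = \sum_(s : 'S_m) (-1) ^+ s * [forall i, l i == k (s i)]%:R.
Proof.
apply: eq_bigr => s _; rewrite -prod_bool; congr (_ * _).
by apply: eq_bigr => i _; rewrite mxE.
Qed.

Lemma jt_signE l al :
  jt_sign l al = \sum_(s : 'S_m) (-1) ^+ s * [forall i, al i + s i == l i]%N%:R.
Proof.
apply: eq_bigr => s _; rewrite -prod_bool; congr (_ * _).
by apply: eq_bigr => i _; rewrite mxE.
Qed.

Lemma jt_sign_neq0 l al : jt_sign l al != 0 ->
  exists s : 'S_m, forall i, (al i + s i)%N = l i.
Proof.
case/det_neq0_perm=> s hs; exists s => i; apply/eqP; move: (hs i); rewrite mxE.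
by case: (_ =P l i).
Qed.

Lemma sum_perm (s : 'S_m) : (\sum_i s i = 'C(m, 2))%N.
Proof.
rewrite -bin2_sum big_mkord; rewrite [RHS](reindex_inj (@perm_inj _ s)) /=.
by [].
Qed.

Lemma jt_sign_sum l al : jt_sign l al != 0 -> (\sum_i al i + 'C(m, 2) = \sum_i l i)%N.
Proof.
case/jt_sign_neq0=> s hs; rewrite -(sum_perm s) -big_split /=.
by apply: eq_bigr.
Qed.

Lemma jt_sign_le l al : jt_sign l al != 0 -> forall i, (al i <= l i)%N.
Proof. by case/jt_sign_neq0=> s hs i; rewrite -hs leq_addr. Qed.

Definition down l a c i := (if i == a then l i - c else l i)%N.
Definition up l a c i := (if i == a then l i + c else l i)%N.

(** True term by term in the Leibniz expansion: for a permutation s, lowering [k (s a)] by c and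
    raising [l a] by c impose the same equations. *)
Lemma delta_det_adjoint l k c :
  \sum_(b | (c <= k b)%N) delta_det l (down k b c) = \sum_a delta_det (up l a c) k.
Proof.
rewrite big_mkcond /=.
transitivity (\sum_b \sum_(s : 'S_m)
   (-1) ^+ s * ([forall i, l i == down k b c (s i)] && (c <= k b)%N)%:R : int).
  apply: eq_bigr => b _; rewrite delta_detE.
  case: (c <= k b)%N; first by under [RHS]eq_bigr => s _ do rewrite andbT.
  by rewrite big1 // => s _; rewrite andbF mulr0.
rewrite exchange_big /=; under [RHS]eq_bigr => a _ do rewrite delta_detE.
rewrite [RHS]exchange_big /=; apply: eq_bigr => s _.
rewrite (reindex_inj (@perm_inj _ s)) /=; apply: eq_bigr => a _; congr (_ * _%:R).
congr (nat_of_bool _); apply/andP/forallP => [[/forallP h ck] i|h].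
  have := h i; rewrite /down /up (inj_eq perm_inj).
  by case: (i =P a) => // -> /eqP->; rewrite subnK.
have ha := h a; rewrite /up eqxx in ha; split; last by rewrite -(eqP ha) leq_addl.
apply/forallP=> i; have := h i; rewrite /down /up (inj_eq perm_inj).
by case: (i =P a) => // -> /eqP<-; rewrite addnK.
Qed.

Lemma delta_det_swap l1 l2 k a b : a != b -> l1 a = l2 b -> l1 b = l2 a ->
  (forall i, i != a -> i != b -> l1 i = l2 i) -> delta_det l1 k = - delta_det l2 k.
Proof.
move=> ab h1 h2 h3.
rewrite /delta_det; set M2 := (X in - \det X); set M1 := (X in \det X).
have -> : M1 = row_perm (tperm a b) M2.
  apply/matrixP=> i j; rewrite !mxE; case: tpermP => [->|->|]; rewrite ?h1 ?h2 //.
  by move=> /eqP ia /eqP ib; rewrite h3.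
by rewrite row_permE det_mulmx det_perm odd_tperm ab expr1 mulN1r.
Qed.

Definition split2 l a b p q i := if i == a then p else if i == b then q else l i.

(* The terms p and T - p cancel, because the determinant is antisymmetric. *)
Lemma delta_det_split l k a b T : a != b ->
  \sum_(0 <= p < T.+1) delta_det (split2 l a b p (T - p)) k = 0.
Proof.
move=> ab; set S := LHS.
suff : S = - S by lia.
rewrite {1}/S big_nat_rev /= add0n -sumrN.
rewrite !big_nat; apply: eq_bigr => p /andP[_ hp].
apply: (@delta_det_swap _ _ _ a b) => //; rewrite /split2.
- by rewrite eqxx [b == a]eq_sym (negPf ab) eqxx subSS.
- by rewrite eqxx [b == a]eq_sym (negPf ab) eqxx subSS subKn.
- by move=> i /negPf-> /negPf->.
Qed.

(** In [delta_det_split] with T = l a + l b, the term p = l a is l itself, smaller p move some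
    amount from a to b, and larger p move some amount from b to a. *)
Lemma delta_det_pair l k a b : a != b ->
  \sum_(c < l a) delta_det (up (down l a c.+1) b c.+1) k
  + \sum_(c < l b) delta_det (up (down l b c.+1) a c.+1) k = - delta_det l k.
Proof.
move=> ab; have := delta_det_split l k (l a + l b) ab.
have ba : b != a by rewrite eq_sym.
rewrite (@big_cat_nat _ _ _ (l a)) //=; last by lia.
rewrite (@big_ltn _ _ _ (l a)); last by lia.
have -> : delta_det (split2 l a b (l a) (l a + l b - l a)) k = delta_det l k.
  apply: delta_det_ext => // i; rewrite /split2.
  by case: (i =P a) => [->//|_]; case: (i =P b) => [->|//]; lia.
have -> : \sum_(0 <= p < l a) delta_det (split2 l a b p (l a + l b - p)) k =
    \sum_(c < l a) delta_det (up (down l a c.+1) b c.+1) k.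
  rewrite big_nat_rev big_mkord; apply: eq_bigr => c _.
  apply: delta_det_ext => // i; rewrite /split2 /up /down.
  case: (i =P a) => [->|]; first by rewrite (negPf ab) add0n.
  by case: (i =P b) => [->|//]; have := ltn_ord c; lia.
have -> : \sum_((l a).+1 <= p < (l a + l b).+1) delta_det (split2 l a b p (l a + l b - p)) k =
    \sum_(c < l b) delta_det (up (down l b c.+1) a c.+1) k.
  rewrite -{1}[(l a).+1]add0n big_addn.
  have -> : ((l a + l b).+1 - (l a).+1 = l b)%N by lia.
  rewrite big_mkord; apply: eq_bigr => c _.
  apply: delta_det_ext => // i; rewrite /split2 /up /down.
  case: (i =P a) => [->|]; first by rewrite (negPf ab); lia.
  by case: (i =P b) => [->|//]; have := ltn_ord c; lia.
by move=> h; lra.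
Qed.

(* Moving c from the coordinate a to the coordinate b <> a, in all possible   *)
(* ways, contributes - 1 for each pair {a, b} by delta_det_pair; the terms    *)
(* with a = b contribute \sum_i l i.                                          *)
Lemma delta_det_rec l k :
  \sum_a \sum_(c < l a) \sum_(b | (c < k b)%N) delta_det (down l a c.+1) (down k b c.+1)
   = ((\sum_i l i)%:Z - 'C(m, 2)%:Z) * delta_det l k.
Proof.
pose f a b := \sum_(c < l a) delta_det (up (down l a c.+1) b c.+1) k.
have -> : \sum_a \sum_(c < l a) \sum_(b | (c < k b)%N)
     delta_det (down l a c.+1) (down k b c.+1) = \sum_a \sum_b f a b.
  apply: eq_bigr => a _; rewrite exchange_big /=; apply: eq_bigr => c _.
  exact: delta_det_adjoint.
have hd a : f a a = (l a)%:Z * delta_det l k.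
  rewrite -natz mulr_natl -[X in _ *+ X]card_ord -sumr_const; apply: eq_bigr => c _.
  apply: delta_det_ext => // i; rewrite /up /down; case: (i =P a) => // ->.
  by rewrite subnK.
pose D := delta_det l k.
have h2 : \sum_a \sum_(b | b != a) (f a b + f b a) = - ((m * m.-1)%N%:Z * D).
  transitivity (\sum_(a < m) \sum_(b < m | b != a) - D).
    apply: eq_bigr => a _; apply: eq_bigr => b ba.
    by rewrite delta_det_pair // eq_sym.
  rewrite -mulNr; under eq_bigr => a _ do rewrite sumr_const.
  have hc (a : 'I_m) : #|[pred b | b != a]| = m.-1.
    by have := cardC1 a; rewrite card_ord.
  under eq_bigr => a _ do rewrite hc.
  by rewrite sumr_const card_ord -mulrnA -mulr_natl mulrN natz mulNr mulnC.
have h3 : \sum_a \sum_(b | b != a) (f a b + f b a) =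
    2 * \sum_a \sum_(b | b != a) f a b.
  under eq_bigr => a _ do rewrite big_split /=.
  rewrite big_split /= mulr2n mulrDl !mul1r; congr (_ + _).
  rewrite (exchange_big_dep xpredT) //=; apply: eq_bigr => a _.
  by apply: eq_bigl => b; rewrite eq_sym.
have h4 : (2 * 'C(m, 2) = m * m.-1)%N by rewrite -mul_bin_diag bin1.
have -> : \sum_a \sum_b f a b = (\sum_i l i)%:Z * D + \sum_a \sum_(b | b != a) f a b.
  rewrite -natz natr_sum mulr_suml -big_split /=; apply: eq_bigr => a _.
  by rewrite (bigD1 a) //= hd natz.
move: h2; rewrite h3 -h4; nia.
Qed.

End Alternants.

(** * Contingency tables *)

(** After sorting, the i-th of m distinct numbers is at least i; a minimal sum forces equality
    everywhere. *)
Lemma inj_sum_min (m : nat) (l : 'I_m -> nat) :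
  injective l -> (\sum_i l i = 'C(m, 2))%N -> forall i, (l i < m)%N.
Proof.
move=> l_inj l_sum; pose s := sort leq (codom l).
have s_size : size s = m by rewrite size_sort size_codom card_ord.
have s_mem x : (x \in s) = (x \in codom l) by rewrite mem_sort.
have s_sorted : sorted ltn s.
  rewrite ltn_sorted_uniq_leq sort_uniq sort_sorted ?andbT; [exact/injectiveP | exact: leq_total].
have s_ge i : (i < m)%N -> (i <= nth 0 s i)%N.
  elim: i => // i IHi im; apply: leq_ltn_trans (IHi (ltnW im)) _.
  by apply: (sorted_ltn_nth ltn_trans) => //; rewrite inE s_size // ltnW.
have s_sum : (\sum_(i < m) nth 0 s i = \sum_(i < m) i)%N.
  rewrite -[RHS](big_mkord xpredT id) bin2_sum -l_sum.
  transitivity (\sum_(x <- s) x)%N; first by rewrite (big_nth 0) s_size big_mkord.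
  by rewrite (perm_big (codom l)) ?perm_sort //= codomE big_map big_enum.
have s_eq (i : 'I_m) : nth 0%N s i = i.
  have /eqP : (\sum_(i < m) (nth 0 s i - i) = 0)%N.
    by rewrite sumnB ?s_sum ?subnn // => j _; apply: s_ge.
  rewrite sum_nat_eq0 => /forallP/(_ i)/=; rewrite subn_eq0 => h.
  by apply/eqP; rewrite eqn_leq h s_ge.
move=> i; have : l i \in s by rewrite s_mem codom_f.
case/(nthP 0%N) => j; rewrite s_size => jm <-.
by rewrite (s_eq (Ordinal jm)).
Qed.

Section Contingency.
Variables (m B : nat).
Implicit Types (l k al : 'I_m -> nat) (a b : 'I_m).
Local Notation cells := {ffun 'I_m * 'I_m -> 'I_B.+1}.
Implicit Types A : cells.

Definition rowsum A i := (\sum_j A (i, j))%N.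
Definition colsum A j := (\sum_i A (i, j))%N.

(** This is the inner product of [jt_char] at l and at k, with pairs of words grouped by contingency
    table. The bound B only makes the tables a finite type. *)
Definition jt_form l k : int := \sum_(A : cells) jt_sign l (rowsum A) * jt_sign k (colsum A).

Lemma jt_sign_up l al a c : (c <= l a)%N -> jt_sign l (up al a c) = jt_sign (down l a c) al.
Proof.
move=> cl; congr (\det _); apply/matrixP=> i j; rewrite !mxE /up /down.
case: (i =P a) => [->|//]; congr (nat_of_bool _)%:R; lia.
Qed.

(** Removing c + 1 from the cell (a, b) is a bijection onto all tables, and by [jt_sign_up] the
    change of the two margins can be moved to l and k. *)
Lemma jt_form_cell l k a b (c : nat) : (forall i, l i <= B)%N ->
  \sum_(A : cells | (c < A (a, b))%N) jt_sign l (rowsum A) * jt_sign k (colsum A) =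
  if (c < l a)%N && (c < k b)%N then jt_form (down l a c.+1) (down k b c.+1) else 0.
Proof.
move=> lB.
have le_row A : (A (a, b) <= rowsum A a)%N by rewrite /rowsum (bigD1 b) //= leq_addr.
have le_col A : (A (a, b) <= colsum A b)%N by rewrite /colsum (bigD1 a) //= leq_addr.
case: ifPn => [/andP[cl ck]|nc]; last first.
  apply: big1 => A cA; apply/eqP; rewrite mulf_eq0.
  apply: contraR nc; rewrite negb_or => /andP[/jt_sign_le/(_ a) h1 /jt_sign_le/(_ b) h2].
  by have := le_row A; have := le_col A; lia.
pose inc A := [ffun p => if p == (a, b) then inord (A p + c.+1) else A p] : cells.
pose dec A := [ffun p => if p == (a, b) then inord (A p - c.+1) else A p] : cells.
rewrite (reindex_onto inc dec) => [|A cA]; last first.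
  apply/ffunP => p; rewrite !ffunE; case: (p =P (a, b)) => [->|//].
  apply: val_inj; rewrite /= [in X in inord X]inordK; last first.
    by rewrite (leq_ltn_trans (leq_subr _ _)).
  by rewrite subnK // inordK.
rewrite big_mkcond /=; apply: eq_bigr => A _; rewrite ffunE eqxx.
have [hB|hB] := leqP (A (a, b) + c.+1) B.
  have -> : dec (inc A) == A.
    apply/eqP/ffunP => p; rewrite !ffunE; case: (p =P (a, b)) => [->|//].
    by apply: val_inj; rewrite /= [in X in inord X]inordK ?ltnS // addnK inordK.
  rewrite inordK ?ltnS // andbT; have -> : (c < A (a, b) + c.+1)%N by lia.
  rewrite -!jt_sign_up //; congr (_ * _); apply: jt_sign_ext => // i.
    rewrite /rowsum /up; case: (i =P a) => [->|ia].
      rewrite [LHS](bigD1 b) //= [in RHS](bigD1 b) //= !ffunE eqxx inordK ?ltnS //.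
      rewrite addnAC; congr (_ + _ + _)%N; apply: eq_bigr => j jb; rewrite !ffunE.
      by case: eqP => // -[] /eqP; rewrite (negPf jb).
    by apply: eq_bigr => j _; rewrite ffunE; case: eqP => // -[].
  rewrite /colsum /up; case: (i =P b) => [->|ia].
    rewrite [LHS](bigD1 a) //= [in RHS](bigD1 a) //= !ffunE eqxx inordK ?ltnS //.
    rewrite addnAC; congr (_ + _ + _)%N; apply: eq_bigr => j jb; rewrite !ffunE.
    by case: eqP => // -[] /eqP; rewrite (negPf jb).
  by apply: eq_bigr => j _; rewrite ffunE; case: eqP => // -[].
(* On overflow [inord] returns 0, which fails the condition on the left; on the right the row sum at
   a is too large for a nonzero sign. *)
have -> : nat_of_ord (inord (A (a, b) + c.+1) : 'I_B.+1) = 0%N.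
  by rewrite /inord /insubd insubN // -ltnNge ltnS.
rewrite /=; apply/esym/eqP; rewrite mulf_eq0; apply/orP; left.
apply/contraT => /jt_sign_le/(_ a); rewrite /down eqxx.
by have := le_row A; have := lB a; lia.
Qed.

(* Every cell A (a, b) is counted as the number of c < A (a, b), and c.+1 is removed from it. *)
Lemma jt_form_rec l k : (forall i, l i <= B)%N ->
  \sum_a \sum_(c < l a) \sum_(b | (c < k b)%N) jt_form (down l a c.+1) (down k b c.+1)
   = ((\sum_i l i)%:Z - 'C(m, 2)%:Z) * jt_form l k.
Proof.
move=> lB; rewrite /jt_form mulr_sumr -/(jt_form).
transitivity (\sum_(A : cells) \sum_a \sum_b \sum_(c < B | (c < A (a, b))%N)
    jt_sign l (rowsum A) * jt_sign k (colsum A)); last first.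
  apply: eq_bigr => A _; rewrite [RHS]mulrA.
  have [->|nz] := eqVneq (jt_sign l (rowsum A)) 0.
    by rewrite mulr0 mul0r; do 3!(apply: big1 => ? _).
  rewrite -mulrA -(jt_sign_sum nz) PoszD addrK.
  move: (jt_sign l _ * _) => e.
  rewrite -natz natr_sum mulr_suml; apply: eq_bigr => a _.
  rewrite natr_sum mulr_suml; apply: eq_bigr => b _.
  rewrite -(big_ord_widen B (fun=> _)); last by rewrite -ltnS.
  by rewrite sumr_const card_ord mulr_natl.
rewrite exchange_big /=; apply: eq_bigr => a _; rewrite [RHS]exchange_big /=.
rewrite (big_ord_widen _ (fun c : nat => \sum_(b | (c < k b)%N)
   jt_form (down l a c.+1) (down k b c.+1)) (lB a)).
under [RHS]eq_bigr => b _.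
  rewrite (exchange_big_dep xpredT) //=.
  under eq_bigr => c _ do rewrite jt_form_cell //.
  over.
rewrite [RHS]exchange_big /= big_mkcond; apply: eq_bigr => c _ /=.
case: ifP => cl; last by rewrite big1.
by rewrite big_mkcond.
Qed.

(** Only the zero table survives. If all l i < m, the two signs are determinants of 0-1 matrices,
    and multiplying one by the transpose of the other gives the matrix of deltas. Otherwise the sign
    of l vanishes, and l is not injective by [inj_sum_min], so the delta matrix has two equal
    rows. *)
Lemma jt_form_base l k : (\sum_i l i = 'C(m, 2))%N -> jt_form l k = delta_det l k.
Proof.
move=> l_sum.
have -> : jt_form l k = jt_sign l (fun=> 0%N) * jt_sign k (fun=> 0%N).
  rewrite /jt_form (bigD1 [ffun=> ord0]) //= big1 ?addr0 => [|A nzA].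
    by congr (_ * _); apply: jt_sign_ext => // i; apply: big1 => j _; rewrite ffunE.
  apply/eqP; rewrite mulf_eq0; apply/orP; left; apply: contraR nzA => /jt_sign_sum.
  rewrite l_sum => h; have /eqP : (\sum_i rowsum A i = 0)%N by lia.
  rewrite sum_nat_eq0 => /forallP h0; apply/eqP/ffunP=> -[i j]; rewrite ffunE.
  have := h0 i; rewrite /= sum_nat_eq0 => /forallP/(_ j)/= /eqP h1; exact: val_inj.
have [/forallP lm|] := boolP [forall i, l i < m]%N.
  rewrite /jt_sign -(det_tr (\matrix_(i, j < m) (0 + j == k i)%N%:R)) -det_mulmx.
  congr (\det _); apply/matrixP => i j; rewrite !mxE.
  rewrite (bigD1 (Ordinal (lm i))) //= !mxE /= add0n eqxx mul1r big1 ?addr0 // => t ht.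
  rewrite !mxE add0n; case: eqP => h; last by rewrite mul0r.
  by case/eqP: ht; apply: val_inj.
rewrite negb_forall => /existsP[i0 hi0].
rewrite (_ : jt_sign l _ = 0) ?mul0r; last first.
  apply/eqP/contraT => /jt_sign_neq0[s /(_ i0)] h.
  by case/negP: hi0; rewrite -h add0n.
have [/injectiveP/inj_sum_min/(_ l_sum) /(_ i0) h|] := boolP (injectiveb l).
  by rewrite h in hi0.
case/injectivePn=> i [j ij lij]; rewrite /delta_det.
by rewrite (determinant_alternate ij) // => t; rewrite !mxE lij.
Qed.

(** Both sides satisfy the same recursion on the sum of l, and its factor is nonzero outside the
    base case. *)
Theorem jt_formE l k : (forall i, l i <= B)%N -> jt_form l k = delta_det l k.
Proof.
have [N] := ubnP (\sum_i l i)%N; elim: N l k => // N IHN l k lN lB.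
have [l_sum|ne] := eqVneq (\sum_i l i)%N 'C(m, 2); first exact: jt_form_base.
have nz : (\sum_i l i)%:Z - 'C(m, 2)%:Z != 0 by lia.
apply: (mulfI nz); rewrite -jt_form_rec // -delta_det_rec.
apply: eq_bigr => a _; apply: eq_bigr => c _; apply: eq_bigr => b cb; apply: IHN.
  rewrite ltnS in lN; apply: leq_trans lN.
  rewrite (bigD1 a) //= [in X in (_ < X)%N](bigD1 a) //= /down eqxx.
  rewrite -addSn leq_add //; first by have := ltn_ord c; lia.
  by apply: leq_sum => i /negPf->.
by move=> i; rewrite /down; case: ifP => // _; rewrite (leq_trans (leq_subr _ _)).
Qed.

End Contingency.

(** * Permutation characters on words *)

Section Words.
Variables (n : nat) (I : finType).
Implicit Types (f : {ffun 'I_n -> I}) (g h : 'S_n) (A : I -> nat).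

Definition content f (a : I) : nat := (\sum_i (f i == a))%N.
Definition has_content A f := [forall a, content f a == A a].
Definition wact f g : {ffun 'I_n -> I} := [ffun i => f (g i)].

Lemma wactM f g h : wact f (g * h)%g = wact (wact f h) g.
Proof. by apply/ffunP => i; rewrite !ffunE permM. Qed.

Lemma wact1 f : wact f 1%g = f.
Proof. by apply/ffunP => i; rewrite ffunE perm1. Qed.

Lemma content_wact f g : content (wact f g) =1 content f.
Proof.
move=> a; rewrite /content [RHS](reindex_inj (@perm_inj _ g)) /=.
by apply: eq_bigr => i _; rewrite ffunE.
Qed.

Lemma sum_content f : (\sum_a content f a = n)%N.
Proof.
rewrite exchange_big /= -[RHS]card_ord -sum1_card; apply: eq_bigr => i _.
by rewrite (bigD1 (f i)) //= eqxx big1 // => a /negPf; rewrite eq_sym => ->.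
Qed.

Lemma content_le f a : (content f a <= n)%N.
Proof. by rewrite -(sum_content f) (bigD1 a) //= leq_addr. Qed.

Lemma content_eq_wact f1 f2 : content f1 =1 content f2 -> exists g, f2 = wact f1 g.
Proof.
move=> f12; pose t f := [tuple f i | i < n].
have ct f a : count_mem a (t f) = content f a.
  by rewrite -sum1_count big_map big_mkcond /= big_enum /=; apply: eq_bigr => i _; case: eqP.
have /tuple_permP[g eg] : perm_eq (t f2) (t f1).
  by apply/allP => a _ /=; rewrite !ct f12.
exists g; apply/ffunP => i; rewrite ffunE.
have := congr1 (fun s => nth (f2 i) s i) eg.
by rewrite -!tnth_nth !tnth_mktuple.
Qed.

Lemma has_contentP A f1 f2 : has_content A f1 -> has_content A f2 -> exists g, f2 = wact f1 g.
Proof.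
move=> /forallP h1 /forallP h2; apply: content_eq_wact => a.
by rewrite (eqP (h1 a)) (eqP (h2 a)).
Qed.

Lemma sum_stab (R : nzSemiRingType) f f0 h0 : f = wact f0 h0 ->
  \sum_g (wact f g == f)%:R = \sum_h (wact f0 h == f)%:R :> R.
Proof.
move=> ef; rewrite [RHS](reindex_inj (mulIg h0)) /=.
by apply: eq_bigr => g _; rewrite wactM -ef.
Qed.

(** Burnside's count: the words of content A form a single orbit. *)
Lemma sum_stab_content (R : nzSemiRingType) A f0 : has_content A f0 ->
  \sum_g \sum_(f | has_content A f) (wact f g == f)%:R = n`!%:R :> R.
Proof.
move=> h0; rewrite exchange_big /=.
transitivity (\sum_(f | has_content A f) \sum_h (wact f0 h == f)%:R : R).
  by apply: eq_bigr => f hf; have [g ->] := has_contentP h0 hf; apply: sum_stab.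
rewrite exchange_big /=; transitivity (\sum_(h : 'S_n) 1 : R).
  apply: eq_bigr => h _; rewrite (bigD1 (wact f0 h)) /=; last first.
    by apply/forallP => a; rewrite content_wact (forallP h0).
  by rewrite eqxx big1 ?addr0 // => f /andP[_ /negPf]; rewrite eq_sym => ->.
by rewrite sumr_const card_Sn.
Qed.

End Words.

(** Induction on the length: fixing the first letter a lowers [A a] by one, and the factor n + 1 is
    split as the sum of the [A a]. *)
Lemma multinomial (I : finType) (n : nat) (A : I -> nat) : (\sum_a A a = n)%N ->
  ((\sum_(f : {ffun 'I_n -> I}) has_content A f) * \prod_a (A a)`! = n`!)%N.
Proof.
elim: n A => [|n IHn] A sA.
  have A0 a : A a = 0%N by apply/eqP; move/eqP: sA; rewrite sum_nat_eq0 => /forallP/(_ a).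
  rewrite [X in (_ * X)%N]big1 => [|a _]; last by rewrite A0.
  rewrite muln1 (eq_bigr (fun=> 1%N)); last first.
    move=> f _; apply/eqP; rewrite eqb1; apply/forallP=> a.
    by rewrite /content big_ord0 A0.
  by rewrite sum1_card card_ffun card_ord expn0.
pose h (p : I * {ffun 'I_n -> I}) : {ffun 'I_n.+1 -> I} :=
  [ffun i => if unlift ord0 i is Some j then p.2 j else p.1].
pose h' (f : {ffun 'I_n.+1 -> I}) := (f ord0, [ffun j => f (lift ord0 j)] : {ffun 'I_n -> I}).
have hK : cancel h h'.
  case=> a f; rewrite /h /h' ffunE unlift_none; congr (_, _).
  by apply/ffunP => j; rewrite !ffunE liftK.
have h'K : cancel h' h.
  by move=> f; apply/ffunP => i; rewrite ffunE; case: unliftP => [j|] -> //=; rewrite ffunE.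
rewrite (reindex h) /=; last by exists h' => ? _.
rewrite -(pair_big xpredT xpredT (fun a f => has_content A (h (a, f)) : nat)) /=.
have -> : (n.+1`! = (\sum_a A a) * n`!)%N by rewrite factS sA.
rewrite !big_distrl /=; apply: eq_bigr => a _.
pose A' b := if b == a then (A b).-1 else A b.
have hc f : has_content A (h (a, f)) = (0 < A a)%N && has_content A' f.
  have ch b : content (h (a, f)) b = ((a == b) + content f b)%N.
    rewrite /content big_ord_recl ffunE unlift_none; congr (_ + _)%N.
    by apply: eq_bigr => i _; rewrite ffunE liftK.
  apply/forallP/andP => [hA|[A0 /forallP hA] b].
    have := hA a; rewrite ch eqxx => /eqP ha; split; first by rewrite -ha.
    apply/forallP => b; rewrite /A'; have := hA b; rewrite ch [a == b]eq_sym.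
    by case: (b =P a) => // -> /eqP <-.
  have := hA b; rewrite ch /A' [a == b]eq_sym.
  by case: (b =P a) => // -> /eqP->; rewrite add1n prednK.
under eq_bigr => f _ do rewrite hc.
have [A0|A0] := posnP (A a).
  by rewrite A0 /= sum_nat_const muln0.
rewrite /= (bigD1 a) //= -[in (A a)`!](prednK A0) factS prednK // -!mulnA mulnCA; congr (_ * _)%N.
rewrite -(IHn A'); last first.
  apply/eqP; rewrite -(eqn_add2l 1) [in X in _ == X]add1n -sA.
  rewrite [in X in _ == X](bigD1 a) //= (bigD1 a) //=.
  rewrite {1}/A' eqxx addnA add1n prednK // eqn_add2l; apply/eqP.
  by apply: eq_bigr => b /negPf; rewrite /A' => ->.
rewrite [in RHS](bigD1 a) //= (_ : A' a = (A a).-1); last by rewrite /A' eqxx.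
congr (_ * (_ * _))%N.
by apply: eq_bigr => b /negPf; rewrite /A' => ->.
Qed.

Lemma has_content_ex (I : finType) (n : nat) (A : I -> nat) : (\sum_a A a = n)%N ->
  exists f : {ffun 'I_n -> I}, has_content A f.
Proof.
move=> /multinomial h; apply/existsP; apply: contraT; rewrite negb_exists => /forallP h0.
move: h; rewrite big1 => [|f _]; last by rewrite (negPf (h0 f)).
by have := fact_gt0 n; case: (n`!).
Qed.

Lemma sum_fixed_words (R : comNzRingType) (I : finType) (n B : nat) (F : (I -> nat) -> R) :
  (forall A1 A2, A1 =1 A2 -> F A1 = F A2) -> (n <= B)%N ->
  \sum_(g : 'S_n) \sum_(f : {ffun 'I_n -> I} | wact f g == f) F (content f) =
  n`!%:R * \sum_(A : {ffun I -> 'I_B.+1} | (\sum_a A a == n)%N) F (fun a => A a).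
Proof.
move=> F_ext nB; rewrite mulr_sumr [RHS]big_mkcond.
transitivity (\sum_(g : 'S_n) \sum_(f : {ffun 'I_n -> I} | wact f g == f)
   \sum_(A : {ffun I -> 'I_B.+1} | has_content (fun a => A a) f) F (fun a => A a)).
  apply: eq_bigr => g _; apply: eq_bigr => f _.
  have cf a : nat_of_ord (inord (content f a) : 'I_B.+1) = content f a.
    by rewrite inordK // ltnS (leq_trans (content_le f a)).
  rewrite (big_pred1 [ffun a => inord (content f a)]) => [|A].
    by apply: F_ext => a; rewrite ffunE cf.
  apply/forallP/eqP => [h|-> a]; last by rewrite ffunE cf.
  by apply/ffunP => a; apply: val_inj; rewrite ffunE /= cf (eqP (h a)).
under [LHS]eq_bigr => g _. rewrite (exchange_big_dep xpredT) //=. over.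
rewrite exchange_big /=; apply: eq_bigr => A _.
have [/eqP sA|sA] := ifPn.
  have [f0 h0] := has_content_ex sA; rewrite -(sum_stab_content _ h0) mulr_suml.
  apply: eq_bigr => g _; rewrite mulr_suml [RHS]big_mkcond [LHS]big_mkcond /=.
  by apply: eq_bigr => f _; case: (wact f g == f); case: (has_content _ f); rewrite ?mul1r ?mul0r.
apply: big1 => g _; apply: big1 => f /andP[_ /forallP h].
case/negP: sA; apply/eqP; rewrite -[RHS](sum_content f).
by apply: eq_bigr => a _; rewrite (eqP (h a)).
Qed.

Section WordCharacters.
Variables (n : nat) (I : finType).
Implicit Types (f : {ffun 'I_n -> I}) (g h : 'S_n) (A : I -> nat).

Definition wstab f := [set g : 'S_n | wact f g == f].

Lemma wstab_group_set f : group_set (wstab f).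
Proof.
apply/group_setP; split=> [|g h]; first by rewrite inE wact1.
by rewrite !inE wactM => /eqP hg /eqP->; rewrite hg.
Qed.
Canonical wstab_group f := Group (wstab_group_set f).

(* All words of content A form one orbit, so a word of content A gives the    *)
(* permutation character on them by induction from its stabiliser.            *)
Definition word_char A : 'CF([set: 'S_n]) :=
  if [pick f | has_content A f] is Some f0 then 'Ind[[set: 'S_n], wstab f0] 1 else 0.

Lemma word_char_char A : word_char A \is a character.
Proof.
rewrite /word_char; case: pickP => [f0 _|_]; last exact: cfun0_char.
exact/cfInd_char/cfun1_char.
Qed.

Lemma word_charE A g :
  word_char A g = \sum_(f | wact f g == f) (has_content A f)%:R.
Proof.
rewrite /word_char; case: pickP => [f0 h0|h0]; last first.
  by rewrite cfunE big1 // => f _; rewrite h0.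
rewrite cfIndE ?subsetT //; apply: (canLR (mulKf _)).
  by rewrite pnatr_eq0 -lt0n cardG_gt0.
transitivity (\sum_(y : 'S_n)
    \sum_(f | has_content A f && (wact f g == f)) (wact f0 y == f)%:R : algC).
  apply: eq_big => [y|y _]; first by rewrite inE.
  rewrite cfun1E inE conjgE !wactM.
  have -> : (wact (wact (wact f0 y) g) y^-1 == f0) = (wact (wact f0 y) g == wact f0 y).
    apply/eqP/eqP => [h|->]; last by rewrite -wactM mulVg wact1.
    by rewrite -{2}h -[RHS]wactM mulgV wact1.
  rewrite big_mkcond (bigD1 (wact f0 y)) //= eqxx big1 ?addr0 => [|f /negPf].
    have -> : has_content A (wact f0 y).
      by apply/forallP => a; rewrite content_wact (forallP h0).
    by case: eqP.
  by rewrite eq_sym => ->; case: ifP.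
rewrite exchange_big /= mulr_sumr [RHS]big_mkcond [LHS]big_mkcond; apply: eq_bigr => f _ /=.
have [hf|] := boolP (has_content A f); last by rewrite /= mulr0 if_same.
case: eqP => //= _; rewrite mulr1.
have [z ->] := has_contentP h0 hf.
rewrite (reindex_inj (mulgI z)) /= -sum1_card natr_sum [RHS]big_mkcond /=.
apply: eq_bigr => y _; rewrite wactM.
have -> : (wact (wact f0 y) z == wact f0 z) = (wact f0 y == f0).
  apply/eqP/eqP => [h|->//].
  by rewrite -[LHS]wact1 -(mulVg z) wactM h -wactM mulVg wact1.
by rewrite inE; case: eqP.
Qed.

End WordCharacters.

(** * Jacobi-Trudi characters *)

Section JacobiTrudi.
Local Opaque jt_sign.
Variables (n m : nat).
Implicit Types (l k : 'I_m -> nat) (g : 'S_n) (w : 'S_m).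

(** The determinant of the complete symmetric functions h of index l i - j, with a product of h
    replaced by the permutation character on words of that content. The side condition discards
    negative indices, which natural subtraction would turn into 0. *)
Definition jt_char l : 'CF([set: 'S_n]) :=
  \sum_(w : 'S_m | [forall i, (w i <= l i)%N]) (-1) ^+ w *: word_char n (fun i => l i - w i)%N.

Lemma jt_char_vchar l : jt_char l \in 'Z[irr [set: 'S_n]]%g.
Proof.
apply: rpred_sum => w _; rewrite scaler_sign.
by case: (w : bool); rewrite ?rpredN char_vchar ?word_char_char.
Qed.

Lemma jt_charE l g :
  jt_char l g = \sum_(f : {ffun 'I_n -> 'I_m} | wact f g == f) (jt_sign l (content f))%:~R.
Proof.
rewrite sum_cfunE.
under [RHS]eq_bigr => f _ do rewrite jt_signE rmorph_sum.
rewrite [RHS]exchange_big /= big_mkcond /=; apply: eq_bigr => w _.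
under [RHS]eq_bigr => f _ do rewrite rmorphM rmorph_sign rmorph_nat.
rewrite -mulr_sumr; case: ifPn => [/forallP wl|].
  rewrite cfunE word_charE; congr (_ * _); apply: eq_bigr => f _; congr (nat_of_bool _)%:R.
  apply: eq_forallb => i; apply/eqP/eqP => [->|<-]; first by rewrite subnK.
  by rewrite addnK.
rewrite negb_forall => /existsP[i hi]; rewrite big1 ?mulr0 // => f _.
case: forallP => // /(_ i)/eqP h; case/negP: hi; by rewrite -h leq_addl.
Qed.

(** Two words fixed by g form one fixed word over pairs of letters; its content is a contingency
    table whose margins are the two contents. Averaging over g leaves one term per table
    ([sum_fixed_words]). *)
Lemma jt_char_dot l k : (\sum_i l i = n + 'C(m, 2))%N ->
  '[jt_char l, jt_char k] = (delta_det l k)%:~R.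
Proof.
move=> sl.
pose B := (\sum_i l i)%N.
have lB i : (l i <= B)%N by rewrite /B (bigD1 i) //= leq_addr.
have nB : (n <= B)%N by rewrite /B sl leq_addr.
rewrite -(jt_formE k lB) cfdotE cardsT card_Sn.
pose F (A : 'I_m * 'I_m -> nat) : algC :=
  (jt_sign l (fun i => \sum_j A (i, j))%N * jt_sign k (fun j => \sum_i A (i, j))%N)%:~R.
have F_ext A1 A2 : A1 =1 A2 -> F A1 = F A2.
  move=> h; congr ((_ * _)%:~R); apply: jt_sign_ext => // i; apply: eq_bigr => j _; exact: h.
apply: (canLR (mulKf _)); first by rewrite pnatr_eq0 -lt0n fact_gt0.
transitivity (\sum_(g : 'S_n) \sum_(f : {ffun 'I_n -> 'I_m * 'I_m} | wact f g == f) F (content f)).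
  apply: eq_big => [g|g _]; first by rewrite inE.
  rewrite !jt_charE [X in _ * X]rmorph_sum /= mulr_suml.
  under [LHS]eq_bigr => f1 _ do rewrite mulr_sumr.
  rewrite pair_big_dep /=.
  pose h (f : {ffun 'I_n -> 'I_m * 'I_m}) : {ffun 'I_n -> 'I_m} * {ffun 'I_n -> 'I_m} :=
    ([ffun i => (f i).1], [ffun i => (f i).2]).
  pose h' (p : {ffun 'I_n -> 'I_m} * {ffun 'I_n -> 'I_m}) : {ffun 'I_n -> 'I_m * 'I_m} :=
    [ffun i => (p.1 i, p.2 i)].
  rewrite (reindex h) /=; last first.
    exists h' => [f _|[f1 f2] _]; first by apply/ffunP=> i; rewrite !ffunE; case: (f i).
    by congr (_, _); apply/ffunP=> i; rewrite !ffunE.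
  apply: eq_big => [f|f _].
    apply/andP/eqP => [[/eqP/ffunP h1 /eqP/ffunP h2]|/ffunP h0].
      apply/ffunP => i; have := h1 i; have := h2 i; rewrite !ffunE.
      by case: (f _) (f _) => ? ? [? ?] /= -> ->.
    by split; apply/eqP/ffunP=> i; have := h0 i; rewrite !ffunE => ->.
  rewrite rmorph_int -intrM /F; congr ((_ * _)%:~R); apply: jt_sign_ext => // a.
    rewrite /content exchange_big /=; apply: eq_bigr => i _; rewrite ffunE.
    rewrite (bigD1 (f i).2) //= big1 ?addn0 => [|b hb].
      by case: (f i) => x y /=; rewrite xpair_eqE eqxx andbT.
    by case: (f i) hb => x y /=; rewrite xpair_eqE [b == y]eq_sym => /negPf->; rewrite andbF.
  rewrite /content exchange_big /=; apply: eq_bigr => i _; rewrite ffunE.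
  rewrite (bigD1 (f i).1) //= big1 ?addn0 => [|b hb].
    by case: (f i) => x y /=; rewrite xpair_eqE eqxx.
  by case: (f i) hb => x y /=; rewrite xpair_eqE [b == x]eq_sym => /negPf->.
rewrite (sum_fixed_words F_ext nB); congr (_ * _); rewrite /jt_form rmorph_sum /= big_mkcond /=.
apply: eq_bigr => A _; case: ifPn => // sA; rewrite -[LHS]/(0%:~R); congr (_%:~R).
apply/esym/eqP; rewrite mulf_eq0; apply/orP; left; apply: contraR sA => /jt_sign_sum.
rewrite sl => /addIn h; rewrite -[X in _ == X]h; apply/eqP.
by rewrite pair_big /=; apply: eq_bigr => -[].
Qed.

End JacobiTrudi.

(** * Degrees in terms of beta-numbers *)

(** Falling factorials are monic polynomials of increasing degree, so the matrix is a unitriangular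
    one times a Vandermonde matrix, up to transposition. *)
Lemma det_ffact (R : comNzRingType) (m : nat) (l : 'I_m -> nat) :
  \det (\matrix_(i, j < m) ((l i ^_ j)%:R : R)) =
  \prod_(i < m) \prod_(j < m | (i < j)%N) ((l j)%:R - (l i)%:R).
Proof.
pose P j : {poly R} := \prod_(t < j) ('X - (t%:R)%:P).
have P_horner j x : (P j).[x%:R] = (x ^_ j)%:R.
  rewrite /P; elim: j => [|j IHj]; first by rewrite big_ord0 hornerC.
  rewrite big_ord_recr hornerM IHj !hornerE ffactnSr natrM.
  have [jx|xj] := leqP j x; first by rewrite natrB.
  by rewrite ffact_small // !mul0r.
have P_size j : size (P j) = j.+1 by rewrite size_prod_XsubC -[index_enum _]enumT size_enum_ord.
have P_lead j : (P j)`_j = 1.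
  have /monicP : P j \is monic by apply: monic_prod_XsubC.
  by rewrite /lead_coef P_size.
pose V := Vandermonde m (\row_j (l j)%:R : 'rV[R]_m).
pose C := \matrix_(j < m, k < m) (P j)`_k.
have -> : \matrix_(i, j < m) ((l i ^_ j)%:R : R) = (C *m V)^T.
  apply/matrixP => i j; rewrite !mxE -P_horner.
  rewrite (@horner_coef_wide _ m) ?P_size //; apply: eq_bigr => k _.
  by rewrite !mxE.
rewrite det_tr det_mulmx det_Vandermonde (det_trig (A := C)) => [|].
  rewrite big1 ?mul1r => [|j _]; last by rewrite !mxE P_lead.
  by apply: eq_bigr => i _; apply: eq_bigr => j _; rewrite !mxE.
apply/is_trig_mxP => j k jk; rewrite mxE nth_default // P_size.
exact: jk.
Qed.

Definition dist (a b : nat) : nat := ((a - b) + (b - a))%N.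

Section Degree.
Variables (n m : nat).
Implicit Types (l k : 'I_m -> nat).

(** Each term is a signed multinomial coefficient; multiplying by the factorials of l turns it into
    a product of falling factorials, a Leibniz term of [det_ffact]. *)
Lemma jt_char1 l : (\sum_i l i = n + 'C(m, 2))%N ->
  jt_char n l 1%g * (\prod_i (l i)`!)%:R =
  n`!%:R * \prod_(i < m) \prod_(j < m | (i < j)%N) ((l j)%:R - (l i)%:R).
Proof.
move=> sl; rewrite -det_ffact /jt_char sum_cfunE mulr_suml mulr_sumr big_mkcond /=.
apply: eq_bigr => w _; case: ifPn => [/forallP wl|]; last first.
  rewrite negb_forall => /existsP[i]; rewrite -ltnNge => hi.
  by rewrite (bigD1 i) //= mxE ffact_small // mul0r !mulr0.
rewrite cfunE word_charE -mulrA [RHS]mulrCA; congr (_ * _).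
have sw : (\sum_i (l i - w i) = n)%N.
  by rewrite sumnB // sl -(sum_perm w) addnK.
rewrite -(multinomial sw) natrM !natr_prod -mulrA; congr (_ * _).
  rewrite natr_sum big_mkcond /=; apply: eq_bigr => f _.
  by rewrite wact1 eqxx.
rewrite -big_split /=; apply: eq_bigr => i _.
by rewrite mxE -natrM mulnC ffact_fact.
Qed.

Definition jt_index l : Iirr [set: 'S_n] :=
  odflt 0 [pick i | '[jt_char n l, 'chi_i] != 0].

Lemma jt_indexP l : (\sum_i l i = n + 'C(m, 2))%N -> injective l ->
  exists b : bool, jt_char n l = (-1) ^+ b *: 'chi_(jt_index l).
Proof.
move=> sl l_inj.
have [|b [i def_i]] := vchar_norm1P (jt_char_vchar n l).
  rewrite jt_char_dot // (_ : delta_det l l = 1) //.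
  rewrite -(det1 _ m); congr (\det _); apply/matrixP => i j.
  by rewrite !mxE (inj_eq l_inj).
exists b; rewrite /jt_index; case: pickP => [j|/(_ i)] /=; rewrite def_i cfdotZl cfdot_irr.
  by case: (i =P j) => [->//|_]; rewrite mulr0 eqxx.
by rewrite eqxx mulr1 signr_eq0.
Qed.

Lemma jt_index_inj l k : (\sum_i l i = n + 'C(m, 2))%N -> (\sum_i k i = n + 'C(m, 2))%N ->
  injective l -> injective k -> jt_index l = jt_index k ->
  exists s : 'S_m, forall i, l i = k (s i).
Proof.
move=> sl sk l_inj k_inj eq_i.
have : delta_det l k != 0.
  rewrite -(intr_eq0 algC) -(jt_char_dot k sl).
  have [b ->] := jt_indexP sl l_inj; have [c ->] := jt_indexP sk k_inj.
  rewrite eq_i cfdotZl cfdotZr cfdot_irr eqxx mulr1 mulf_neq0 ?signr_eq0 //.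
  by rewrite rmorph_sign signr_eq0.
case/det_neq0_perm=> s hs; exists s => i; apply/eqP.
by have := hs i; rewrite mxE; case: (_ =P k _).
Qed.

Lemma dist_sqr (R : comNzRingType) (a b : nat) :
  ((a%:R - b%:R) ^+ 2 = (dist a b)%:R * (dist b a)%:R :> R).
Proof.
rewrite /dist; have [ab|/ltnW ba] := leqP a b.
  rewrite (eqP ab) add0n addn0 natrB // -expr2 -sqrrN opprB //.
by rewrite (eqP ba) addn0 add0n natrB // expr2.
Qed.

(** Squaring removes the unknown sign and lets the product run over ordered pairs. *)
Lemma jt_index_degree l : (\sum_i l i = n + 'C(m, 2))%N -> injective l ->
  'chi_(jt_index l) 1%g ^+ 2 * (\prod_i (l i)`! ^ 2)%:R =
  (n`! ^ 2 * \prod_i \prod_(j | j != i) dist (l i) (l j))%:R.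
Proof.
move=> sl l_inj; have [b def_l] := jt_indexP sl l_inj.
have := congr1 (fun x => x ^+ 2) (jt_char1 sl); rewrite def_l cfunE !exprMn.
rewrite sqrr_sign mul1r => h.
rewrite natr_prod; under eq_bigr => i _ do rewrite natrX.
rewrite prodrXl -natr_prod h natrM natrX; congr (_ * _).
under [in RHS]eq_bigr => i _ do rewrite (bigID (fun j : 'I_m => (i < j)%N)) /=.
rewrite big_split /= natrM.
have -> : (\prod_(i < m) \prod_(j < m | (j != i) && ~~ (i < j)) dist (l i) (l j) =
   \prod_(i < m) \prod_(j < m | i < j) dist (l j) (l i))%N.
  rewrite (exchange_big_dep xpredT) //=; apply: eq_bigr => i _.
  apply: eq_bigl => j; rewrite -leqNgt ltn_neqAle; congr (_ && _).
have -> : (\prod_(i < m) \prod_(j < m | (j != i) && (i < j)) dist (l i) (l j) =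
   \prod_(i < m) \prod_(j < m | i < j) dist (l i) (l j))%N.
  apply: eq_bigr => i _; apply: eq_bigl => j.
  by case: ltngtP => // ij; rewrite ?andbF // andbT; apply: contraTneq ij => ->; rewrite ltnn.
rewrite -natrM -big_split natr_prod -prodrXl; apply: eq_bigr => i _.
rewrite -big_split natr_prod -prodrXl; apply: eq_bigr => j _.
by rewrite natrM dist_sqr mulrC.
Qed.

End Degree.

(** * Irreducible characters attached to sets of beta-numbers *)

Section BetaSets.
Variables (T : finType) (pos : T -> nat) (n m : nat).
Hypothesis pos_inj : injective pos.
Implicit Types (X : {set T}).

Definition beta_set X := (#|X| == m) && (\sum_(x in X) pos x == n + 'C(m, 2))%N.

Definition beta_seq X (i : 'I_m) : nat := nth 0%N [seq pos x | x <- enum X] i.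

Definition beta_index X := jt_index n (beta_seq X).

Lemma big_beta_seq (R : Type) (idx : R) (op : Monoid.com_law idx) X (F : nat -> R) :
  #|X| = m -> \big[op/idx]_(i < m) F (beta_seq X i) = \big[op/idx]_(x in X) F (pos x).
Proof.
move=> Xm; rewrite -[RHS]big_enum -(big_map pos xpredT F) (big_nth 0%N) size_map -cardE Xm.
by rewrite big_mkord.
Qed.

Lemma beta_seq_inj X : #|X| = m -> injective (beta_seq X).
Proof.
move=> Xm i j /eqP; rewrite nth_uniq ?size_map -?cardE ?Xm //.
  by move/eqP/val_inj.
by rewrite map_inj_uniq // enum_uniq.
Qed.

Lemma beta_seq_sum X : beta_set X -> (\sum_i beta_seq X i = n + 'C(m, 2))%N.
Proof. by case/andP=> /eqP Xm /eqP <-; rewrite (big_beta_seq _ id). Qed.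

Lemma mem_beta_seq X x : #|X| = m -> (x \in X) = [exists i, beta_seq X i == pos x].
Proof.
move=> Xm; rewrite -mem_enum -(mem_map pos_inj).
apply/(nthP 0%N)/existsP => [[i]|[i /eqP <-]].
  by rewrite size_map -cardE Xm => im hi; exists (Ordinal im); rewrite -hi.
by exists i => //; rewrite size_map -cardE Xm.
Qed.

Lemma beta_index_inj : {in beta_set &, injective beta_index}.
Proof.
move=> X Y bX bY eqXY.
have /andP[/eqP Xm _] := bX; have /andP[/eqP Ym _] := bY.
have [s hs] := jt_index_inj (beta_seq_sum bX) (beta_seq_sum bY)
  (beta_seq_inj Xm) (beta_seq_inj Ym) eqXY.
apply/setP => x; rewrite !mem_beta_seq //; apply/existsP/existsP => -[i /eqP hi].
  by exists (s i); rewrite -hs hi.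
by exists (s^-1%g i); rewrite hs permKV hi.
Qed.

Lemma beta_index_degree X : beta_set X ->
  'chi_(beta_index X) 1%g ^+ 2 * (\prod_(x in X) (pos x)`! ^ 2)%:R =
  (n`! ^ 2 * \prod_(x in X) \prod_(y in X | y != x) dist (pos x) (pos y))%:R.
Proof.
move=> bX; have /andP[/eqP Xm _] := bX.
rewrite -(@big_beta_seq _ _ _ _ (fun a => a`! ^ 2)%N Xm).
rewrite (jt_index_degree (beta_seq_sum bX) (beta_seq_inj Xm)); congr ((_ * _)%:R).
transitivity (\prod_(i < m) \prod_(x in X | pos x != beta_seq X i) dist (beta_seq X i) (pos x))%N.
  apply: eq_bigr => i _; rewrite big_mkcond [RHS]big_mkcondr.
  rewrite -(@big_beta_seq _ _ _ _ (fun a =>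
    if a != beta_seq X i then dist (beta_seq X i) a else 1%N)) //.
  by apply: eq_bigr => j _; rewrite (inj_eq (beta_seq_inj Xm)).
rewrite (@big_beta_seq _ _ _ _ (fun a => \prod_(x in X | pos x != a) dist a (pos x))%N Xm).
by apply: eq_bigr => x _; apply: eq_bigl => y; rewrite (inj_eq pos_inj).
Qed.

End BetaSets.

(** * Symmetric sets of beta-numbers *)

Section SymmetricDiagram.
Local Open Scope nat_scope.
Variable m : nat.
Implicit Types (a c : 'I_m) (U W Y : {set 'I_m}).

(* The two positions attached to a are symmetric about m - 1/2, at distance   *)
(* a + 1/2.                                                                   *)
Definition maya (p : 'I_m * bool) : nat := if p.2 then m + p.1 else m - p.1.+1.

(* gap a c = |a(a+1) - c(c+1)| = |u^2 - v^2| for u = a + 1/2 and v = c + 1/2. *)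
Definition gap a c : nat := dist a c * (a + c).+1.

Lemma gap_gt0 a c : a != c -> 0 < gap a c.
Proof.
move=> ac; rewrite /gap /dist muln_gt0 andbT; move: ac.
by rewrite -(inj_eq val_inj) /=; lia.
Qed.

Lemma maya_inj : injective maya.
Proof.
case=> a b [c d]; rewrite /maya /=; have := ltn_ord a; have := ltn_ord c.
by case: b d => [] [] hc ha h; first [congr (_, _); apply: val_inj => /=; lia | exfalso; lia].
Qed.

Lemma prod_dist (a d : nat) : \prod_(c < (a + d).+1 | c != a :> nat) dist a c = a`! * d`!.
Proof.
elim: d => [|d IHd].
  rewrite addn0 muln1 fact_prod big_add1 /= big_mkord big_mkcond big_ord_recr /= eqxx muln1.
  rewrite (reindex_inj rev_ord_inj) /=; apply: eq_bigr => i _.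
  by have := ltn_ord i; rewrite /dist; case: eqP => /=; lia.
rewrite addnS big_mkcond big_ord_recr /= -big_mkcond IHd.
rewrite factS -mulnA [d`! * _]mulnC; congr (_ * (_ * _)).
by rewrite /dist; case: eqP => /=; lia.
Qed.

Lemma prod_shift (a k : nat) : a`! * \prod_(c < k) (a + c).+1 = (a + k)`!.
Proof.
elim: k => [|k IHk]; first by rewrite big_ord0 muln1 addn0.
by rewrite big_ord_recr /= mulnA IHk addnS factS mulnC.
Qed.

(** The reason only the cut survives in the degree: the factorials of the two positions of a amount
    to their mutual distance times all the gaps from a. *)
Lemma prod_gap a : (a + a).+1 * \prod_(c | c != a) gap a c = (m + a)`! * (m - a.+1)`!.
Proof.
rewrite big_split /= mulnCA.
have -> : (a + a).+1 * \prod_(c < m | c != a) (a + c).+1 = \prod_(c < m) (a + c).+1.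
  by rewrite [RHS](bigD1 a).
have em : (a + (m - a.+1)).+1 = m by have := ltn_ord a; lia.
have -> : \prod_(c : 'I_m | c != a) dist a c = a`! * (m - a.+1)`!.
  by have := prod_dist a (m - a.+1); rewrite em.
by rewrite mulnAC prod_shift addnC.
Qed.

Variables (W Y : {set 'I_m}).

Definition diagram U : {set 'I_m * bool} :=
  [set p | if p.1 \in W then p.1 \in U else p.2 == (p.1 \in Y)].

Definition background a := (a, a \in Y).

Lemma big_diagram (R : Type) (idx : R) (op : Monoid.com_law idx) U (F : 'I_m * bool -> R) :
  U \subset W -> \big[op/idx]_(p in diagram U) F p =
  op (\big[op/idx]_(a in U) op (F (a, true)) (F (a, false)))
     (\big[op/idx]_(a in ~: W) F (background a)).
Proof.
move=> UW.
transitivity (\big[op/idx]_a \big[op/idx]_b (if (a, b) \in diagram U then F (a, b) else idx)).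
  by rewrite pair_big big_mkcond; apply: eq_bigr => -[].
rewrite [X in op X _]big_mkcond [X in op _ X]big_mkcond -big_split; apply: eq_bigr => a _ /=.
rewrite big_bool !inE /=; have [aW|aW] := boolP (a \in W).
  by case: ifP => _; rewrite ?Monoid.mulm1.
have -> : (a \in U) = false by apply: contraNF aW; apply: (subsetP UW).
by rewrite /background; case: (a \in Y); rewrite /= ?Monoid.mulm1 ?Monoid.mul1m.
Qed.

Lemma diagram_inj U1 U2 : U1 \subset W -> U2 \subset W -> diagram U1 = diagram U2 -> U1 = U2.
Proof.
move=> /subsetP s1 /subsetP s2 /setP h; apply/setP => a; have := h (a, true); rewrite !inE /=.
case: ifP => // aW _; have na : a \notin W by rewrite aW.
by rewrite (contraNF (s1 a) na) (contraNF (s2 a) na).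
Qed.

Lemma card_diagram U : U \subset W -> #|W| = 2 * #|U| -> #|diagram U| = m.
Proof.
move=> UW cW; rewrite -sum1_card big_diagram //= !sum_nat_const muln1 mulnC -cW.
by rewrite cardsC card_ord.
Qed.

(** A pair taken whole sums to 2m - 1 whatever a is. The lower positions together sum to 'C(m, 2),
    and each a in Y raises its position by 2a + 1. *)
Lemma sum_diagram n U : U \subset W -> #|W| = 2 * #|U| -> [disjoint Y & W] ->
  2 * n = \sum_(a in W) a.*2.+1 + 2 * \sum_(a in Y) a.*2.+1 ->
  \sum_(p in diagram U) maya p = n + 'C(m, 2).
Proof.
move=> UW cW dYW hn; rewrite big_diagram //=.
have -> : \sum_(a in U) (maya (a, true) + maya (a, false)) = #|U| * m.*2.-1.
  by rewrite -sum_nat_const; apply: eq_bigr => a _; rewrite /maya /=; have := ltn_ord a; lia.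
have hY : \sum_(a in ~: W) maya (background a) =
    \sum_(a in ~: W) (m - a.+1) + \sum_(a in Y) a.*2.+1.
  have -> : \sum_(a in Y) a.*2.+1 = \sum_(a in ~: W) (if a \in Y then a.*2.+1 else 0).
    rewrite -big_mkcondr; apply: eq_bigl => a; rewrite inE.
    by case: (boolP (a \in Y)) => [/(disjointFr dYW)->|]; rewrite ?andbF.
  rewrite -big_split; apply: eq_bigr => a _; rewrite /maya /background /=.
  by case: ifP => _; have := ltn_ord a; lia.
have hm : 2 * 'C(m, 2) = 2 * \sum_(a in W) (m - a.+1) + 2 * \sum_(a in ~: W) (m - a.+1).
  rewrite -mulnDr; congr (_ * _); rewrite -(sum_perm (1%g : 'S_m)).
  rewrite (reindex_inj rev_ord_inj) /= (bigID (mem W)) /=.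
  by congr (_ + _); apply: eq_big => a; rewrite ?inE // perm1.
have hW : \sum_(a in W) m.*2.-1 = 2 * \sum_(a in W) (m - a.+1) + \sum_(a in W) a.*2.+1.
  rewrite big_distrr -big_split; apply: eq_bigr => a _ /=.
  by have := ltn_ord a; lia.
move: hW; rewrite sum_nat_const cW => hW.
apply/eqP; rewrite -(eqn_pmul2l (isT : 0 < 2)); apply/eqP; rewrite hY !mulnDr hm hn mulnA hW; lia.
Qed.

Definition cut U := \prod_(a in U) \prod_(c in W :\: U) gap a c.

Definition maya_dist p q := if q != p then dist (maya p) (maya q) else 1.

Lemma maya_dist_pair a c b : a != c ->
  maya_dist (a, true) (c, b) * maya_dist (a, false) (c, b) = gap a c /\
  maya_dist (c, b) (a, true) * maya_dist (c, b) (a, false) = gap a c.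
Proof.
move=> ac; have ca : c != a by rewrite eq_sym.
rewrite /maya_dist !xpair_eqE (negPf ac) (negPf ca) /= /maya /gap /=.
have up x y : dist (m + x) (m + y) = dist x y by rewrite /dist; lia.
have down (x y : 'I_m) : dist (m - x.+1) (m - y.+1) = dist x y.
  by rewrite /dist; have := ltn_ord x; have := ltn_ord y; lia.
have across (x y : 'I_m) : dist (m + x) (m - y.+1) = (x + y).+1.
  by rewrite /dist; have := ltn_ord x; have := ltn_ord y; lia.
have distC x y : dist x y = dist y x by rewrite /dist addnC.
by case: b; rewrite ?[dist (m - _) (m + _)]distC ?up ?down ?across [dist c a]distC
  ?[c + a]addnC; split=> //; rewrite mulnC.
Qed.

Lemma maya_dist_same a :
  maya_dist (a, true) (a, false) = (a + a).+1 /\ maya_dist (a, false) (a, true) = (a + a).+1.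
Proof.
by rewrite /maya_dist !xpair_eqE !andbF /= /maya /dist /=; have := ltn_ord a; lia.
Qed.

Lemma maya_dist1 p : maya_dist p p = 1.
Proof. by rewrite /maya_dist eqxx. Qed.

Definition bg_dist := \prod_(a in ~: W) \prod_(c in ~: W) maya_dist (background a) (background c).
Definition bg_fact := \prod_(a in ~: W) (maya (background a))`!.

(** The degree formula cleared of denominators: [bg_dist] and [bg_fact] do not involve U, and the
    factorials of U are absorbed by [prod_gap]. *)
Lemma prod_dist_diagram U : U \subset W ->
  (\prod_(p in diagram U) \prod_(q in diagram U | q != p) dist (maya p) (maya q)) * cut U ^ 2
    * bg_fact ^ 2 = bg_dist * (\prod_(p in diagram U) (maya p)`!) ^ 2.
Proof.
move=> UW; have WU a c : a \in U -> c \in ~: W -> a != c.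
  by rewrite inE => aU; apply: contraNneq => <-; apply: (subsetP UW).
rewrite [\prod_(p in diagram U) (maya p)`!]big_diagram //= -/bg_fact.
have -> : \prod_(p in diagram U) \prod_(q in diagram U | q != p) dist (maya p) (maya q) =
   \prod_(p in diagram U) \prod_(q in diagram U) maya_dist p q.
  by apply: eq_bigr => p _; rewrite big_mkcondr.
rewrite big_diagram //=.
have -> : \prod_(a in ~: W) \prod_(q in diagram U) maya_dist (background a) q =
    (\prod_(a in U) \prod_(c in ~: W) gap a c) * bg_dist.
  rewrite [\prod_(a in U) _]exchange_big /bg_dist -big_split; apply: eq_bigr => a aW /=.
  rewrite big_diagram //=; congr (_ * _); apply: eq_bigr => c cU.
  by have [_ ->] := maya_dist_pair (a \in Y) (WU c a cU aW).
set P := \prod_(a in U) (_ * _); set Q := \prod_(a in U) _; set R := \prod_(a in U) (_ * _).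
have -> : P * (Q * bg_dist) * cut U ^ 2 * bg_fact ^ 2 = bg_dist * (P * Q * cut U ^ 2) * bg_fact ^ 2.
  by ring.
(* For each a in U, both sides are the square of 2a + 1 times the gaps from a to U, to the rest of W
   and to the complement of W. *)
suff -> : P * Q * cut U ^ 2 = R ^ 2 by rewrite expnMn mulnA.
rewrite {}/P {}/Q {}/R.
rewrite /cut.
rewrite -!mulnn -!big_split; apply: eq_bigr => a aU /=; rewrite -!big_split /=.
rewrite big_diagram //=.
have -> : \prod_(c in ~: W) (maya_dist (a, true) (background c) *
    maya_dist (a, false) (background c)) =
   \prod_(c in ~: W) gap a c.
  by apply: eq_bigr => c cW; have [-> _] := maya_dist_pair (c \in Y) (WU a c aU cW).
rewrite (bigD1 a) //= !maya_dist1 !mul1n muln1.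
have [-> ->] := maya_dist_same a.
have -> : \prod_(c in U | c != a) (maya_dist (a, true) (c, true) * maya_dist (a, false) (c, true) *
     (maya_dist (a, true) (c, false) * maya_dist (a, false) (c, false))) =
   \prod_(c in U | c != a) (gap a c * gap a c).
  apply: eq_bigr => c /andP[_ ca]; have ac : a != c by rewrite eq_sym.
  by have [-> _] := maya_dist_pair true ac; have [-> _] := maya_dist_pair false ac.
rewrite -/(maya (a, true)) -/(maya (a, false)) -prod_gap.
have -> : \prod_(c < m | c != a) gap a c = \prod_(c in U | c != a) gap a c *
    (\prod_(c in W :\: U) gap a c * \prod_(c in ~: W) gap a c).
  rewrite (bigID (mem U)) /= [X in _ * X](bigID (mem W)) /=.
  congr (_ * (_ * _)); apply: eq_bigl => c; rewrite ?inE.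
  - by rewrite andbC.
  - by case: eqVneq => [->|_] //=; rewrite aU.
  - have [cW|cW] := boolP (c \in W); rewrite ?andbF ?andbT //.
    apply/andP; split; last by apply: contraNN cW; apply: (subsetP UW).
    by apply: contraNneq cW => ->; apply: (subsetP UW).
by rewrite !big_split /=; ring.
Qed.

End SymmetricDiagram.

(** * Characters of symmetric diagrams *)

Section DiagramCharacters.
Variables (n m : nat) (W Y : {set 'I_m}).
Hypothesis dYW : [disjoint Y & W].
Hypothesis size_n : (2 * n = \sum_(a in W) a.*2.+1 + 2 * \sum_(a in Y) a.*2.+1)%N.
Implicit Types U : {set 'I_m}.

Definition halving U := (U \subset W) && (#|W| == 2 * #|U|)%N.

Definition diagram_index U := beta_index (@maya m) n m (diagram W Y U).

Lemma diagram_beta_set U : halving U -> beta_set (@maya m) n m (diagram W Y U).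
Proof.
by case/andP=> UW /eqP cW; rewrite /beta_set card_diagram // (sum_diagram UW cW dYW size_n) !eqxx.
Qed.

Lemma diagram_index_inj : {in halving &, injective diagram_index}.
Proof.
move=> U1 U2 h1 h2 /(beta_index_inj (@maya_inj m)) eqU; have [s1 _] := andP h1.
have [s2 _] := andP h2; apply: (diagram_inj s1 s2 (Y := Y)); apply: eqU; exact: diagram_beta_set.
Qed.

Lemma cut_gt0 U : U \subset W -> (0 < cut W U)%N.
Proof.
move=> UW; apply: prodn_cond_gt0 => a aU; apply: prodn_cond_gt0 => c; rewrite inE => /andP[cU _].
by apply: gap_gt0; apply: contraNneq cU => <-.
Qed.

Lemma diagram_index_degree U1 U2 : halving U1 -> halving U2 ->
  'chi_(diagram_index U1) 1%g * (cut W U1)%:R = 'chi_(diagram_index U2) 1%g * (cut W U2)%:R.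
Proof.
suff main U : halving U ->
  ('chi_(diagram_index U) 1%g * (cut W U)%:R) ^+ 2 * (bg_fact W Y ^ 2)%:R =
  (n`! ^ 2 * bg_dist W Y)%:R.
  move=> h1 h2; apply/eqP.
  have pos U : 0 <= 'chi_(diagram_index U) 1%g * (cut W U)%:R.
    by rewrite mulr_ge0 ?ler0n // ltW // irr1_gt0.
  rewrite -(eqrXn2 (n := 2)) ?pos //; apply/eqP.
  apply: (@mulIf _ (bg_fact W Y ^ 2)%:R); last by rewrite !main.
  by rewrite pnatr_eq0 -lt0n expn_gt0 prodn_cond_gt0 // => a _; rewrite fact_gt0.
move=> hU; have [UW _] := andP hU.
have := beta_index_degree (@maya_inj m) (diagram_beta_set hU).
have := prod_dist_diagram Y UW.
set D := (\prod_(p in _) \prod_(q in _ | _) _)%N; rewrite -/(diagram_index U) => h1 h2.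
have Fsq : (\prod_(x in diagram W Y U) (maya x)`! ^ 2 =
    (\prod_(p in diagram W Y U) (maya p)`!) ^ 2)%N.
  by rewrite -[RHS]mulnn -big_split /=; apply: eq_bigr => p _; rewrite mulnn.
rewrite Fsq in h2; set F := (\prod_(p in _) _)%N in h1 h2.
have F0 : (F ^ 2)%:R != 0 :> algC.
  by rewrite pnatr_eq0 -lt0n expn_gt0 prodn_cond_gt0 // => p _; rewrite fact_gt0.
apply: (mulIf F0); rewrite exprMn -natrX -2!mulrA [X in _ * X]mulrCA.
have -> : (n`! ^ 2 * bg_dist W Y)%:R * (F ^ 2)%:R =
  ((n`! ^ 2 * D)%:R * (cut W U ^ 2)%:R * (bg_fact W Y ^ 2)%:R : algC).
  by rewrite -!natrM; congr (_%:R); rewrite -mulnA -h1 !mulnA.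
rewrite -h2; ring.
Qed.

End DiagramCharacters.

(** * Sign patterns with equal autocorrelation *)

Section Signings.
Variables (J : finType) (s : J -> bool).

Definition corr (F : J -> J -> int) : int :=
  \sum_i \sum_j (-1) ^+ (s i) * (-1) ^+ (s j) * F i j.

(** Twice the indicator of s i <> s j is 1 minus the product of the two signs. *)
Lemma sum_cut (F : J -> J -> int) :
  2 * (\sum_i \sum_(j | s i != s j) F i j) = (\sum_i \sum_j F i j) - corr F.
Proof.
rewrite /corr -sumrB mulr_sumr; apply: eq_bigr => i _.
rewrite -sumrB mulr_sumr [LHS]big_mkcond; apply: eq_bigr => j _ /=.
by case: (s i) (s j) => [] [] /=; rewrite ?expr0 ?expr1; ring.
Qed.

Definition balanced := \sum_i (-1) ^+ (s i) = 0 :> int.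

Lemma corr_additive (f g : J -> int) : balanced -> corr (fun i j => f i + g j) = 0.
Proof.
move=> s0; rewrite /corr.
have -> : \sum_i \sum_j (-1) ^+ (s i) * (-1) ^+ (s j) * (f i + g j) =
   (\sum_i (-1) ^+ (s i) * f i) * (\sum_j (-1) ^+ (s j)) +
   (\sum_i (-1) ^+ (s i)) * (\sum_j (-1) ^+ (s j) * g j).
  rewrite !mulr_suml -big_split; apply: eq_bigr => i _.
  by rewrite /= !mulr_sumr -big_split; apply: eq_bigr => j _ /=; ring.
by rewrite s0 mulr0 mul0r addr0.
Qed.

End Signings.

Lemma corrB (J : finType) (s : J -> bool) (F G : J -> J -> int) :
  corr s (fun i j => F i j - G i j) = corr s F - corr s G.
Proof.
rewrite /corr -sumrB; apply: eq_bigr => i _; rewrite -sumrB; apply: eq_bigr => j _.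
by rewrite mulrBr.
Qed.

Lemma eq_corr (J : finType) (s : J -> bool) (F G : J -> J -> int) :
  (forall i j, F i j = G i j) -> corr s F = corr s G.
Proof. by move=> h; apply: eq_bigr => i _; apply: eq_bigr => j _; rewrite h. Qed.

Lemma ternary_inj (l : nat) (x y : 'I_l -> nat) :
  (forall t, x t < 3)%N -> (forall t, y t < 3)%N ->
  (\sum_t x t * 3 ^ t = \sum_t y t * 3 ^ t)%N -> x =1 y.
Proof.
elim: l x y => [x y _ _ _ []//|l IHl x y hx hy].
have sumE (z : 'I_l.+1 -> nat) : (\sum_t z t * 3 ^ t =
    z ord0 + 3 * \sum_t z (lift ord0 t) * 3 ^ t)%N.
  rewrite big_ord_recl muln1 big_distrr; congr (_ + _)%N; apply: eq_bigr => t _ /=.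
  by rewrite /bump add1n expnS mulnCA.
rewrite !sumE => h; have := hx ord0; have := hy ord0 => h1 h2 t.
have h0 : x ord0 = y ord0 by lia.
case: (unliftP ord0 t) => [t' ->|->] //.
move/eqP: h; rewrite h0 eqn_add2l eqn_pmul2l // => /eqP h.
exact: (IHl (fun t => x (lift ord0 t)) (fun t => y (lift ord0 t))).
Qed.

Lemma logn_prod (p : nat) (I : finType) (P : pred I) (F : I -> nat) :
  (forall i, P i -> 0 < F i)%N -> logn p (\prod_(i | P i) F i) = (\sum_(i | P i) logn p (F i))%N.
Proof.
move=> hF.
suff [//] : (logn p (\prod_(i | P i) F i) = \sum_(i | P i) logn p (F i) /\
   0 < \prod_(i | P i) F i)%N.
apply: (big_ind2 (fun x y => logn p x = y /\ 0 < x)%N) => [|x1 x2 y1 y2 [<- h1] [<- h2]|i Pi].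
- by rewrite logn1.
- by rewrite lognM // muln_gt0 h1.
- by split=> //; apply: hF.
Qed.

Lemma sum_dist (k d : nat) :
  (2 * \sum_(h < (k + d).+1) dist h k = k * k.+1 + d * d.+1)%N.
Proof.
elim: d => [|d IHd].
  rewrite addn0 addn0; elim: k => [|k IHk].
    by rewrite big_ord_recl big_ord0.
  rewrite big_ord_recr /= (eq_bigr (fun h : 'I_k.+1 => dist h k + 1)%N); last first.
    by move=> h _; rewrite /dist; have := ltn_ord h; lia.
  rewrite big_split /= sum_nat_const card_ord mulnDr mulnDr IHk /dist; nia.
by rewrite addnS big_ord_recr /= mulnDr IHd /dist; nia.
Qed.

(** * Gaps between halved powers of three *)

Section Powers.
Local Open Scope nat_scope.

Definition half3 (e : nat) := (3 ^ e.+1)./2.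

Lemma half3E e : (half3 e).*2.+1 = 3 ^ e.+1.
Proof. by rewrite /half3 -[RHS]odd_double_half oddX. Qed.

(* gap3 is gap at half3 e and half3 f, on natural numbers. *)
Definition gap3 (e f : nat) := dist (half3 e) (half3 f) * (half3 e + half3 f).+1.

Lemma gap3E e f : 4 * gap3 e f = dist (9 ^ e.+1) (9 ^ f.+1).
Proof.
have sq u : 9 ^ u = 3 ^ u * 3 ^ u by rewrite -expnMn.
rewrite !sq -!half3E /gap3 /dist; case: (leqP (half3 e) (half3 f)); nia.
Qed.

(** A gap is 9 ^ e times a function of f - e, by [gap3E]. *)
Lemma gap3_shift e1 f1 e2 f2 : e1 + f2 = e2 + f1 -> gap3 e1 f1 * 9 ^ e2 = gap3 e2 f2 * 9 ^ e1.
Proof.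
move=> h; have h' : 9 ^ e1 * 9 ^ f2 = 9 ^ e2 * 9 ^ f1 by rewrite -!expnD h.
have : dist (9 ^ e1.+1) (9 ^ f1.+1) * 9 ^ e2 = dist (9 ^ e2.+1) (9 ^ f2.+1) * 9 ^ e1.
  by rewrite /dist !expnS !mulnDl !mulnBl; congr (_ + _); congr (_ - _); nia.
by rewrite -!gap3E; lia.
Qed.

Lemma gap3_gt0 e f : e != f -> 0 < gap3 e f.
Proof.
move=> ef; rewrite -(@ltn_pmul2l 4) // muln0 gap3E /dist.
have : 9 ^ e.+1 != 9 ^ f.+1 by rewrite eqn_exp2l.
by lia.
Qed.

Lemma gap3C e f : gap3 e f = gap3 f e.
Proof. by rewrite /gap3 /dist addnC [half3 e + _]addnC. Qed.

(** The valuation is 2 (min e f + 1), and twice the minimum is the sum minus the distance. *)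
Lemma logn_gap3 e f : e != f -> logn 3 (gap3 e f) + dist e f = e + f + 2.
Proof.
wlog ef : e f / e < f.
  move=> H ne; case: (ltngtP e f) (ne) => // h _; first exact: H.
  have := H f e h; rewrite eq_sym gap3C (_ : dist f e = dist e f) => [/(_ ne)|]; first by lia.
  by rewrite /dist addnC.
move=> ne; have -> : logn 3 (gap3 e f) = logn 3 (4 * gap3 e f).
  by rewrite lognM ?gap3_gt0 // (logn_coprime (m := 4)).
have -> : 4 * gap3 e f = 9 ^ e.+1 * (9 * 9 ^ (f - e.+1) - 1).
  rewrite gap3E /dist (_ : 9 ^ f.+1 = 9 ^ e.+1 * (9 * 9 ^ (f - e.+1))).
    by have := expn_gt0 9 (f - e.+1); nia.
  by rewrite -expnS -expnD; congr (_ ^ _); lia.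
have pos : 0 < 9 ^ (f - e.+1) by rewrite expn_gt0.
rewrite lognM ?expn_gt0 //; last by lia.
rewrite [X in _ + X + _]logn_coprime; last by rewrite prime_coprime //; lia.
rewrite (_ : 9 = 3 ^ 2) // -expnM pfactorK // /dist; lia.
Qed.

End Powers.

(** * Kronecker product patterns and their cuts *)

Section Signs.
Variables k l : nat.
Local Notation R := k.*2.
Definition low := ('I_R * bool)%type.
(** Three values per digit, since a sign pattern of length two is reversed into itself or its
    negative. *)
Definition high := {ffun 'I_l -> 'I_3}.
Implicit Types (c : low) (x : high) (j : low * high).

Definition low_pos c : nat := (c.1 + R * c.2)%N.
Definition high_pos x : nat := (\sum_t x t * 3 ^ t)%N.
Definition expo j : nat := (low_pos j.1 + R.*2 * high_pos j.2)%N.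

Lemma low_pos_lt c : (low_pos c < R.*2)%N.
Proof. by rewrite /low_pos; case: c => h [] /=; have := ltn_ord h; lia. Qed.

Lemma low_pos_inj : injective low_pos.
Proof.
case=> h b [h' b']; rewrite /low_pos /= => e; have := ltn_ord h; have := ltn_ord h'.
by case: b b' e => [] [] /= e i1 i2; first [congr (_, _); apply: val_inj => /=; lia | exfalso; lia].
Qed.

Lemma high_pos_inj : injective high_pos.
Proof. by move=> x y /ternary_inj h; apply/ffunP => t; apply/val_inj/h. Qed.

Lemma expo_lt j j' : (high_pos j.2 < high_pos j'.2)%N -> (expo j < expo j')%N.
Proof. by rewrite /expo; have := low_pos_lt j.1; nia. Qed.

Lemma expo_inj : injective expo.
Proof.
move=> [c x] [c' x'] e.
have ex : high_pos x = high_pos x'.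
  by case: (ltngtP (high_pos x) (high_pos x')) => // h;
    [have := @expo_lt (c, x) (c', x') h | have := @expo_lt (c', x') (c, x) h]; rewrite e ltnn.
congr (_, _); last exact: high_pos_inj.
by apply: low_pos_inj; move: e; rewrite /expo /= ex; lia.
Qed.

(** A single minus sign at [kap], tensored with the pattern +, -, which makes the result
    balanced. *)
Definition low_sign (kap : nat) c : bool := (c.1 == kap :> nat) (+) c.2.
(* Only the digit i is reversed, so i >= l stands for the unreversed pattern. *)
Definition high_sign (i : nat) x : bool :=
  \big[addb/false]_t (x t == (if t == i :> nat then ord0 else ord_max)).
Definition sgn kap i j : bool := low_sign kap j.1 (+) high_sign i j.2.

Lemma low_sign_balanced kap : balanced (low_sign kap).
Proof.
rewrite /balanced; rewrite -(pair_big xpredT xpredT (fun h b => (-1) ^+ low_sign kap (h, b))) /=.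
apply: big1 => h _; rewrite big_bool /low_sign /=.
by case: (_ == _).
Qed.

Lemma sgn_balanced kap i : balanced (sgn kap i).
Proof.
rewrite /balanced -(pair_big xpredT xpredT (fun c x => (-1) ^+ sgn kap i (c, x))) /=.
under eq_bigr => c _ do under eq_bigr => x _ do rewrite /sgn signr_addb /=.
by under eq_bigr => c _ do rewrite -mulr_sumr; rewrite -mulr_suml low_sign_balanced mul0r.
Qed.

(* For x <> x' the distance of the exponents is affine in the low digits, so  *)
(* these terms vanish because the low pattern is balanced.                    *)
Lemma corr_sgn kap i :
  corr (sgn kap i) (fun j j' => (dist (expo j) (expo j'))%:Z) =
  (#|{: high}|)%:Z * corr (low_sign kap) (fun c c' => (dist (low_pos c) (low_pos c'))%:Z).
Proof.
rewrite {1}/corr.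
transitivity (\sum_x \sum_x' \sum_(c : low) \sum_(c' : low)
   (-1) ^+ (high_sign i x) * (-1) ^+ (high_sign i x') *
   ((-1) ^+ (low_sign kap c) * (-1) ^+ (low_sign kap c') *
     (dist (expo (c, x)) (expo (c', x')))%:Z) : int).
  rewrite -(pair_big xpredT xpredT (fun c x =>
    \sum_j (-1) ^+ sgn kap i (c, x) * (-1) ^+ sgn kap i j *
      (dist (expo (c, x)) (expo j))%:Z)) /=.
  rewrite exchange_big /=; apply: eq_bigr => x _; rewrite [RHS]exchange_big /=.
  apply: eq_bigr => c _.
  rewrite -(pair_big xpredT xpredT (fun c' x' =>
    (-1) ^+ sgn kap i (c, x) * (-1) ^+ sgn kap i (c', x') *
      (dist (expo (c, x)) (expo (c', x')))%:Z)) /=.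
  rewrite exchange_big /=; apply: eq_bigr => x' _; apply: eq_bigr => c' _.
  by rewrite /sgn !signr_addb /=; ring.
have inner x x' : \sum_(c : low) \sum_(c' : low)
   (-1) ^+ (high_sign i x) * (-1) ^+ (high_sign i x') *
   ((-1) ^+ (low_sign kap c) * (-1) ^+ (low_sign kap c') *
     (dist (expo (c, x)) (expo (c', x')))%:Z) =
   (x == x')%:R * corr (low_sign kap) (fun c c' => (dist (low_pos c) (low_pos c'))%:Z) :> int.
  transitivity ((-1) ^+ (high_sign i x) * (-1) ^+ (high_sign i x') *
    corr (low_sign kap) (fun c c' => (dist (expo (c, x)) (expo (c', x')))%:Z)).
    by rewrite /corr mulr_sumr; apply: eq_bigr => c _; rewrite mulr_sumr.
  have [<-|ne] := eqVneq x x'.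
    rewrite -signr_addb addbb !mul1r; apply: eq_corr => c c'.
    by rewrite /expo /dist /=; congr Posz; lia.
  rewrite mul0r; have [h|h] : (high_pos x < high_pos x')%N \/ (high_pos x' < high_pos x)%N.
  - have : high_pos x != high_pos x' by rewrite (inj_eq high_pos_inj).
    by lia.
  - rewrite (_ : corr _ _ = 0) ?mulr0 //.
    rewrite -(corr_additive (fun c => - (expo (c, x))%:Z)
      (fun c' => (expo (c', x'))%:Z) (low_sign_balanced kap)).
    apply: eq_corr => c c'; have := @expo_lt (c, x) (c', x') h.
    rewrite /dist /=; move: (expo (c, x)) (expo (c', x')) => a b; lia.
  rewrite (_ : corr _ _ = 0) ?mulr0 //.
  rewrite -(corr_additive (fun c => (expo (c, x))%:Z)
    (fun c' => - (expo (c', x'))%:Z) (low_sign_balanced kap)).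
  apply: eq_corr => c c'; have := @expo_lt (c', x') (c, x) h.
  by rewrite /dist /=; move: (expo (c, x)) (expo (c', x')) => a b; lia.
under eq_bigr => x _ do under eq_bigr => x' _ do rewrite inner.
under eq_bigr => x _.
  rewrite (bigD1 x) //= eqxx mul1r big1 ?addr0 => [|x']; last first.
    by rewrite eq_sym => /negPf->; rewrite mul0r.
  over.
by rewrite sumr_const -mulr_natl natz.
Qed.

(** Expanding the signs as 1 - 2 delta shows that [kap] enters only through its total distance to
    the R positions. *)
Lemma corr_low kap : (kap < k)%N ->
  corr (low_sign kap) (fun c c' => (dist (low_pos c) (low_pos c'))%:Z) =
  2 * (\sum_(h < R) \sum_(h' < R) (dist h h')%:Z) - 8 * (\sum_(h < R) dist h kap)%:Z
   - 2 * R%:Z * (R%:Z - 2) ^+ 2.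
Proof.
move=> kapk.
have kapR : (kap < R)%N by lia.
pose kp := Ordinal kapR.
pose eta (h : 'I_R) : int := (-1) ^+ (h == kp).
have etaE h : eta h = 1 - 2 * (h == kp)%:R.
  by rewrite /eta; case: eqP.
have kpsum (f : 'I_R -> int) : \sum_(h < R) (h == kp)%:R * f h = f kp.
  rewrite (bigD1 kp) //= eqxx mul1r big1 ?addr0 // => h /negPf->; by rewrite mul0r.
have kpsum1 : \sum_(h < R) (h == kp)%:R = 1 :> int.
  by rewrite -[RHS](kpsum (fun=> 1)); apply: eq_bigr => h _; rewrite mulr1.
have eta_sum : \sum_(h < R) eta h = R%:Z - 2.
  under eq_bigr => h _ do rewrite etaE.
  by rewrite sumrB sumr_const card_ord -mulr_sumr kpsum1 mulr1 natz.
(* Equal halves contribute the distance of h and h' twice; opposite halves contribute R + h - h' and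
   R + h' - h with a minus sign. *)
transitivity (\sum_(h < R) \sum_(h' < R) eta h * eta h' * (2 * (dist h h')%:Z - 2 * R%:Z)).
  rewrite /corr -(pair_big xpredT xpredT (fun h b =>
    \sum_c' (-1) ^+ low_sign kap (h, b) * (-1) ^+ low_sign kap c' *
      (dist (low_pos (h, b)) (low_pos c'))%:Z)) /=.
  apply: eq_bigr => h _.
  under eq_bigr => b _.
    rewrite -(pair_big xpredT xpredT (fun h' b' =>
      (-1) ^+ low_sign kap (h, b) * (-1) ^+ low_sign kap (h', b') *
        (dist (low_pos (h, b)) (low_pos (h', b')))%:Z)) /=.
    over.
  rewrite exchange_big /=; apply: eq_bigr => h' _.
  rewrite !big_bool /= /low_sign /low_pos /= !signr_addb.
  rewrite -[(h == kap :> nat)]/(h == kp) -[(h' == kap :> nat)]/(h' == kp) -/(eta h) -/(eta h').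
  have d1 : dist (h + R * 1) (h' + R * 1) = dist h h' by rewrite /dist; lia.
  have d2 : dist (h + R * 0) (h' + R * 0) = dist h h' by rewrite /dist; lia.
  have d3 : (dist (h + R * 1) (h' + R * 0))%:Z = h%:Z + R%:Z - h'%:Z.
    by rewrite /dist; have := ltn_ord h; have := ltn_ord h'; lia.
  have d4 : (dist (h + R * 0) (h' + R * 1))%:Z = h'%:Z + R%:Z - h%:Z.
    by rewrite /dist; have := ltn_ord h; have := ltn_ord h'; lia.
  by rewrite d1 d2 d3 d4 expr0 expr1; ring.
have -> : \sum_(h < R) \sum_(h' < R) eta h * eta h' * (2 * (dist h h')%:Z - 2 * R%:Z) =
   2 * (\sum_(h < R) \sum_(h' < R) eta h * eta h' * (dist h h')%:Z) -
   2 * R%:Z * ((\sum_(h < R) eta h) * (\sum_(h' < R) eta h')).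
  rewrite big_distrlr /= !mulr_sumr -sumrB; apply: eq_bigr => h _.
  rewrite !mulr_sumr -sumrB; apply: eq_bigr => h' _; ring.
rewrite eta_sum -expr2; congr (_ - _).
have -> : \sum_(h < R) \sum_(h' < R) eta h * eta h' * (dist h h')%:Z =
   \sum_(h < R) \sum_(h' < R) (dist h h')%:Z
     - 2 * \sum_(h < R) (dist h kp)%:Z - 2 * \sum_(h < R) (dist h kp)%:Z.
  transitivity (\sum_(h < R) \sum_(h' < R) ((dist h h')%:Z - 2 * ((h' == kp)%:R * (dist h h')%:Z)
     - 2 * ((h == kp)%:R * (dist h h')%:Z)
     + 4 * ((h == kp)%:R * ((h' == kp)%:R * (dist h h')%:Z))) : int).
    by apply: eq_bigr => h _; apply: eq_bigr => h' _; rewrite !etaE; ring.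
  under eq_bigr => h _.
    rewrite big_split sumrB sumrB /= -!mulr_sumr !kpsum.
    over.
  rewrite big_split sumrB sumrB /= -!mulr_sumr !kpsum.
  rewrite (_ : dist kp kp = 0%N) ?mulr0 ?addr0; last by rewrite /dist; lia.
  congr (_ - _ - _ * _); apply: eq_bigr => h _; by rewrite /dist addnC.
have -> : (\sum_(h < R) dist h kap)%:Z = \sum_(h < R) (dist h kp)%:Z.
  by rewrite -natz natr_sum; apply: eq_bigr => h _; rewrite natz.
ring.
Qed.

(* The product runs over ordered pairs: each pair across the cut occurs twice. *)
Definition cut_square kap i :=
  (\prod_j \prod_(j' | sgn kap i j != sgn kap i j') gap3 (expo j) (expo j'))%N.

(** By [logn_gap3] the valuation of a gap is additive in the exponents up to their distance; the
    additive part has no correlation with a balanced pattern. *)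
Lemma cut_square_logn kap i :
  2 * (logn 3 (cut_square kap i))%:Z =
  \sum_(j : low * high) \sum_j' ((expo j)%:Z + ((expo j')%:Z + 2) - (dist (expo j) (expo j'))%:Z)
  + corr (sgn kap i) (fun j j' => (dist (expo j) (expo j'))%:Z).
Proof.
have ne j j' : sgn kap i j != sgn kap i j' -> expo j != expo j'.
  by apply: contraNneq => /expo_inj->.
have -> : (logn 3 (cut_square kap i))%:Z = \sum_j \sum_(j' | sgn kap i j != sgn kap i j')
    ((expo j)%:Z + ((expo j')%:Z + 2) - (dist (expo j) (expo j'))%:Z).
  rewrite logn_prod => [|j _]; last first.
    by apply: prodn_cond_gt0 => j' /ne; apply: gap3_gt0.
  rewrite -natz natr_sum; apply: eq_bigr => j _.
  rewrite logn_prod => [|j' /ne]; last exact: gap3_gt0.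
  rewrite natr_sum; apply: eq_bigr => j' /ne/logn_gap3; rewrite natz; lia.
rewrite sum_cut corrB corr_additive ?sub0r ?opprK //; exact: sgn_balanced.
Qed.

Lemma cut_square_inj i kap1 kap2 : (kap1 < k)%N -> (kap2 < k)%N ->
  cut_square kap1 i = cut_square kap2 i -> kap1 = kap2.
Proof.
move=> h1 h2 eqS.
have := cut_square_logn kap1 i; rewrite eqS cut_square_logn => /addrI.
rewrite !corr_sgn => /mulfI; rewrite !corr_low // => /(_ _) heq.
have nz : (#|{: high}|)%:Z != 0 by rewrite card_ffun !card_ord eqz_nat -lt0n expn_gt0.
have {heq nz} := heq nz.
have e kap : (kap < k)%N ->
    (2 * \sum_(h < R) dist h kap = kap * kap.+1 + (R - kap.+1) * (R - kap.+1).+1)%N.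
  move=> hk; rewrite -sum_dist; have -> // : ((kap + (R - kap.+1)).+1 = R)%N by lia.
move: (\sum_(h < R) dist h kap1)%N (\sum_(h < R) dist h kap2)%N
  (e _ h1) (e _ h2) => f1 f2 e1 e2 heq.
have {heq} ef : f1 = f2 by lia.
have {f1 f2 ef e1 e2} : (kap1 * kap1.+1 + (R - kap1.+1) * (R - kap1.+1).+1 =
    kap2 * kap2.+1 + (R - kap2.+1) * (R - kap2.+1).+1)%N by rewrite -e1 -e2 ef.
(* Used with a = kap1, t = kap2 - kap1 and b = R - kap2 - 1; a < b because both indices lie in the
   lower half of the R positions, where the total distance strictly decreases. *)
have aux a b t : (a < b)%N ->
    ((a + t) * (a + t).+1 + b * b.+1 = a * a.+1 + (b + t) * (b + t).+1)%N -> t = 0%N.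
  by case: t => // t; nia.
move=> {eqS}; wlog le12 : kap1 kap2 h1 h2 / (kap1 <= kap2)%N => [hw|] h.
  by case: (leqP kap1 kap2) => [|/ltnW] /hw ->.
have := aux kap1 (R - kap2.+1)%N (kap2 - kap1)%N; rewrite subnKC //.
rewrite (_ : R - kap2.+1 + (kap2 - kap1) = R - kap1.+1)%N; last by lia.
by rewrite -h => /(_ _ erefl); lia.
Qed.

(* Reversing the digit i in a pair and exchanging its two values preserves    *)
(* the difference of the exponents.                                           *)
Definition swap_digit (i : 'I_l) (p : (low * high) * (low * high)) : (low * high) * (low * high) :=
  ((p.1.1, [ffun t => if t == i then rev_ord (p.2.2 t) else p.1.2 t]),
   (p.2.1, [ffun t => if t == i then rev_ord (p.1.2 t) else p.2.2 t])).

Lemma swap_digitK i : involutive (swap_digit i).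
Proof.
case=> -[c x] [c' x']; rewrite /swap_digit /=.
by congr ((_, _), (_, _)); apply/ffunP => t; rewrite !ffunE;
  case: eqP => // _; rewrite ?eqxx rev_ordK.
Qed.

(** The reversed pattern at a reversed digit is the plain pattern at the digit, and the product of
    the two signs does not see their exchange. *)
Lemma swap_digit_sgn kap (i : 'I_l) p : let q := swap_digit i p in
  (sgn kap i q.1 != sgn kap i q.2) = (sgn kap l p.1 != sgn kap l p.2).
Proof.
case: p => -[c x] [c' x'] /=; rewrite /sgn /swap_digit /=.
have hs (y z : high) : high_sign i [ffun t => if t == i then rev_ord (z t) else y t] =
    (z i == ord_max) (+) (y i == ord_max) (+) high_sign l y.
  rewrite /high_sign (bigD1 i) //= [in RHS](bigD1 i) //= ffunE !eqxx (ltn_eqF (ltn_ord i)).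
  rewrite addbA addbK; congr (_ (+) _).
    by rewrite -!(inj_eq val_inj) /=; case: (z i) => -[|[|[|]]].
  apply: eq_bigr => t ti; rewrite ffunE (negPf ti) (ltn_eqF (ltn_ord t)).
  by rewrite (inj_eq val_inj) (negPf ti).
rewrite !hs; case: (x i == _); case: (x' i == _); case: (low_sign _ c); case: (low_sign _ c');
  by case: (high_sign l x); case: (high_sign l x').
Qed.

Lemma swap_digit_expo (i : 'I_l) p : let q := swap_digit i p in
  (expo q.1 + expo p.2 = expo p.1 + expo q.2)%N.
Proof.
case: p => -[c x] [c' x'] /=; rewrite /expo /swap_digit /=.
have hp (y z : high) : (high_pos [ffun t => if t == i then rev_ord (z t) else y t] + y i * 3 ^ i =
    high_pos y + rev_ord (z i) * 3 ^ i)%N.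
  rewrite /high_pos (bigD1 i) //= [in RHS](bigD1 i) //= ffunE eqxx /=.
  rewrite (eq_bigr (fun t => y t * 3 ^ t)%N) => [|t /negPf ti]; last by rewrite ffunE ti.
  by rewrite addnC [X in (_ + X)%N]addnC addnA.
have hrev (z : high) : (rev_ord (z i) * 3 ^ i + z i * 3 ^ i = 2 * 3 ^ i)%N.
  by rewrite -mulnDl; congr (_ * _)%N => /=; have := ltn_ord (z i); lia.
have := hp x x'; have := hp x' x; have := hrev x; have := hrev x'.
set H2 := high_pos [ffun t => _]; set H1 := high_pos [ffun t => _].
move: (x i * _)%N (x' i * _)%N (rev_ord (x i) * _)%N (rev_ord (x' i) * _)%N => a1 a2 a3 a4.
move=> h1 h2 h3 h4; have /(congr1 (muln R.*2)) : (H1 + high_pos x' = high_pos x + H2)%N by lia.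
rewrite !mulnDr; lia.
Qed.

Lemma cut_square_pair kap i : cut_square kap i =
  (\prod_(p | sgn kap i p.1 != sgn kap i p.2) gap3 (expo p.1) (expo p.2))%N.
Proof. by rewrite /cut_square pair_big_dep. Qed.

(** For a balanced pattern this sum is half of the sum over all pairs, whatever the pattern. *)
Lemma cut_sum_expo kap i : 2 * (\sum_(p | sgn kap i p.1 != sgn kap i p.2) expo p.1)%:Z =
  \sum_(j : low * high) \sum_(j' : low * high) ((expo j)%:Z + 0).
Proof.
have := sum_cut (sgn kap i) (fun j _ => (expo j)%:Z + 0).
have -> : corr (sgn kap i) (fun j _ => (expo j)%:Z + 0) = 0.
  exact: (corr_additive (fun j => (expo j)%:Z) (fun=> 0) (sgn_balanced kap i)).
rewrite subr0 => <-; congr (2 * _); rewrite pair_big_dep -natz natr_sum.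
by apply: eq_bigr => p _; rewrite addr0 natz.
Qed.

(** [swap_digit] carries one cut onto the other and changes each gap by a power of 9 only; these
    powers cancel overall by [cut_sum_expo]. *)
Lemma cut_square_digit kap (i : 'I_l) : cut_square kap i = cut_square kap l.
Proof.
rewrite !cut_square_pair (reindex_inj (inv_inj (swap_digitK i))) /=.
rewrite (eq_bigl _ _ (swap_digit_sgn kap i)).
pose E := (\sum_(p | sgn kap l p.1 != sgn kap l p.2) expo p.1)%N.
have hE : (\sum_(p | sgn kap l p.1 != sgn kap l p.2) expo (swap_digit i p).1)%N = E.
  rewrite -(eq_bigl _ _ (swap_digit_sgn kap i)).
  rewrite -(reindex_inj (inv_inj (swap_digitK i))
    (P := fun p => sgn kap i p.1 != sgn kap i p.2) (F := fun p => expo p.1)).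
  apply/eqP; rewrite -eqz_nat; apply/eqP/(@mulfI int 2) => //.
  by rewrite cut_sum_expo /E cut_sum_expo.
apply/eqP; rewrite -(@eqn_pmul2r (9 ^ E)) ?expn_gt0 //; apply/eqP.
rewrite -{2}hE /E !expn_sum -!big_split; apply: eq_bigr => p _ /=.
by apply: gap3_shift; apply: swap_digit_expo.
Qed.

Lemma sgn_neq kap (i1 i2 : 'I_l) : (0 < k)%N -> i1 != i2 -> exists j, sgn kap i1 j != sgn kap i2 j.
Proof.
move=> k0 ne; have R0 : (0 < R)%N by lia.
(* The middle value 1 is positive in both patterns, and 0 is negative only in the reversed one, so x
   is negative for [i1] and positive for [i2]. *)
pose x : high := [ffun t => if t == i1 then ord0 else inord 1].
exists ((Ordinal R0, false), x); rewrite /sgn /=.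
have n0 : (inord 1 == ord0 :> 'I_3) = false by rewrite -val_eqE /= inordK.
have n2 : (inord 1 == ord_max :> 'I_3) = false by rewrite -val_eqE /= inordK.
have s1 : high_sign i1 x.
  rewrite /high_sign (bigD1 i1) //= ffunE !eqxx big1 // => t ti.
  by rewrite ffunE (negPf ti) (inj_eq val_inj) (negPf ti).
have s2 : high_sign i2 x = false.
  rewrite /high_sign big1 // => t _; rewrite ffunE (inj_eq val_inj).
  have [->|_] := eqVneq t i1; first by rewrite (negPf ne).
  by case: ifP.
by rewrite s1 s2; case: (low_sign _ _).
Qed.

Lemma card_sgn kap i : (#|{: low * high}| = 2 * #|[set j | sgn kap i j]|)%N.
Proof.
pose p := #|[pred j | sgn kap i j]|; pose q := #|[predC [pred j | sgn kap i j]]|.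
have pq : #|{: low * high}| = (p + q)%N by rewrite cardC.
have -> : #|[set j | sgn kap i j]| = p by rewrite cardsE.
suff : - p%:Z + q%:Z = 0 by rewrite pq; lia.
rewrite -[RHS](sgn_balanced kap i) (bigID (sgn kap i)) /=; congr (_ + _).
  by rewrite -natz -mulNrn -sumr_const; apply: eq_big => [//|j]; rewrite inE => ->.
by rewrite -natz -sumr_const; apply: eq_big => [//|j]; rewrite !inE => /negPf->.
Qed.

End Signs.

(** * Families of characters of equal degree *)

Section Assembly.
Variables k l n : nat.
Local Notation J := (low k * high l)%type.
Implicit Types (j : J).

Definition power_sum := (\sum_(j : J) 3 ^ (expo j).+1)%N.

Lemma half3_lt_power_sum j : (half3 (expo j) < power_sum)%N.
Proof.
rewrite /power_sum (bigD1 j) //= -half3E; lia.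
Qed.

Lemma odd_power_sum : odd power_sum = false.
Proof.
have -> : power_sum = (2 * (\sum_(j : J) half3 (expo j) + #|[set j : J | sgn 0 0 j]|))%N.
  rewrite mulnDr -card_sgn /power_sum -sum1_card big_distrr -big_split /=.
  by apply: eq_bigr => j _; rewrite -half3E; lia.
by rewrite oddM.
Qed.

Hypothesis n_large : (3 * power_sum + 4 <= n)%N.

Definition digit j : 'I_n.+1 := inord (half3 (expo j)).

Lemma digitE j : digit j = half3 (expo j) :> nat.
Proof. by rewrite inordK //; have := half3_lt_power_sum j; lia. Qed.

Lemma digit_inj : injective digit.
Proof.
move=> i j /(congr1 (@nat_of_ord _)); rewrite !digitE => h.
have : (3 ^ (expo i).+1 = 3 ^ (expo j).+1)%N by rewrite -!half3E h.
by move/eqP; rewrite eqn_exp2l // eqSS => /eqP/expo_inj.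
Qed.

Definition digits := [set digit j | j : J].
Definition positive kap i := [set digit j | j in [set j : J | sgn kap i j]].

Lemma positive_halving kap i : halving digits (positive kap i).
Proof.
apply/andP; split; first by apply/subsetP => _ /imsetP[j _ ->]; apply: imset_f.
by rewrite !(card_imset _ digit_inj) -card_sgn.
Qed.

Lemma cut_sqr kap i : (cut digits (positive kap i) ^ 2 = cut_square k l kap i)%N.
Proof.
have -> : cut digits (positive kap i) =
    (\prod_(j : J | sgn kap i j) \prod_(j' : J | ~~ sgn kap i j') gap3 (expo j) (expo j'))%N.
  rewrite /cut /positive big_imset /=; last by move=> ? ? _ _; apply: digit_inj.
  apply: eq_big => [j|j _]; first by rewrite inE.
  have -> : digits :\: [set digit j | j in [set j : J | sgn kap i j]] =
      [set digit j | j in [set j : J | ~~ sgn kap i j]].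
    apply/setP => a; rewrite inE; apply/andP/imsetP => [[na /imsetP[j' _ ea]]|[j' hj' ->]].
      by exists j' => //; rewrite inE; apply: contra na => hj'; rewrite ea imset_f // inE.
    by rewrite (mem_imset _ _ digit_inj) imset_f // inE; move: hj'; rewrite inE.
  rewrite big_imset /=; last by move=> ? ? _ _; apply: digit_inj.
  apply: eq_big => [j'|j' _]; first by rewrite inE.
  by rewrite /gap /gap3 !digitE.
rewrite /cut_square [RHS](bigID (sgn kap i)) /= -mulnn; congr (_ * _)%N.
  by apply: eq_bigr => j ->; apply: eq_bigl => j'; case: (sgn kap i j').
rewrite exchange_big /=; apply: eq_bigr => j /negPf ->.
apply: eq_big => j'; first by case: (sgn kap i j').
by move=> _; apply: gap3C.
Qed.

(* Symmetric hooks (a | a), of size 2a + 1, with n - power_sum./2 cells in all. *)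
Definition hooks : {set 'I_n.+1} := let d := (n - power_sum./2)%N in
  if odd d then [set inord d./2] else [set ord0; inord (d./2).-1].

(** The digits lie strictly between 0 and [power_sum]; by [n_large] the long hook lies beyond
    [power_sum]. *)
Lemma hooks_disjoint : [disjoint hooks & digits].
Proof.
have h a : (a \in digits) -> (0 < a < power_sum)%N.
  case/imsetP => j _ ->; rewrite digitE half3_lt_power_sum andbT.
  have := half3E (expo j); rewrite expnS; have := expn_gt0 3 (expo j); lia.
rewrite disjoint_sym; apply/pred0P => a /=; apply/negP => /andP[/h /andP[a0 aN]].
rewrite /hooks; case: ifP => _; rewrite !inE.
  by move=> /eqP ea; move: aN; rewrite ea inordK; lia.
case/orP => /eqP ea; first by move: a0; rewrite ea.
by move: aN; rewrite ea inordK; lia.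
Qed.

Lemma hooks_size :
  (2 * n = \sum_(a in digits) a.*2.+1 + 2 * \sum_(a in hooks) a.*2.+1)%N.
Proof.
rewrite big_imset /=; last by move=> ? ? _ _; apply: digit_inj.
have -> : (\sum_(j : J) (digit j).*2.+1 = power_sum)%N.
  by apply: eq_bigr => j _; rewrite digitE half3E.
have := odd_power_sum; rewrite /hooks; case: ifP => hd he.
  by rewrite big_set1 inordK; lia.
rewrite setUC big_setU1 ?big_set1 /=.
  by rewrite inordK; lia.
by rewrite inE -(inj_eq val_inj) /= inordK; lia.
Qed.

Definition char_index kap i := diagram_index n digits hooks (positive kap i).

Lemma char_index_degree kap1 i1 kap2 i2 :
  ('chi_(char_index kap1 i1) 1%g == 'chi_(char_index kap2 i2) 1%g) =
  (cut_square k l kap1 i1 == cut_square k l kap2 i2).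
Proof.
rewrite -!cut_sqr eqn_exp2r //.
have := diagram_index_degree hooks_disjoint hooks_size
  (positive_halving kap1 i1) (positive_halving kap2 i2).
rewrite -/(char_index kap1 i1) -/(char_index kap2 i2) => h.
have cut0 kap i : (cut digits (positive kap i))%:R != 0 :> algC.
  by rewrite pnatr_eq0 -lt0n cut_gt0 //; have /andP[] := positive_halving kap i.
rewrite -(eqr_nat algC); apply/eqP/eqP => e.
  by move: h; rewrite e => /(mulfI (irr1_neq0 _)).
by move: h; rewrite e => /(mulIf (cut0 _ _)).
Qed.

Lemma char_index_inj kap : (0 < k)%N -> {in 'I_l &, injective (fun i : 'I_l => char_index kap i)}.
Proof.
move=> k0 i1 i2 _ _ /(diagram_index_inj hooks_disjoint hooks_size
  (positive_halving kap i1) (positive_halving kap i2))/setP e.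
apply/eqP/contraT => /(sgn_neq kap k0)[j]; have := e (digit j).
by rewrite !(mem_imset _ _ digit_inj) !inE => ->; rewrite eqxx.
Qed.

Lemma equidegree_exists : (0 < k)%N -> exists A : {ffun 'I_k -> {set Iirr [set: 'S_n]}},
  equidegree_family (G := [set: 'S_n]%G) l A.
Proof.
move=> k0; exists [ffun kap : 'I_k => [set char_index kap i | i : 'I_l]].
have deg (kap1 kap2 : 'I_k) (i1 i2 : 'I_l) :
    ('chi_(char_index kap1 i1) 1%g == 'chi_(char_index kap2 i2) 1%g) = (kap1 == kap2).
  rewrite char_index_degree !cut_square_digit.
  by apply/eqP/eqP => [/cut_square_inj h|->//]; apply: val_inj; apply: h.
apply/and4P; split.
- apply/forallP => kap; rewrite ffunE card_in_imset ?card_ord //.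
  by apply: char_index_inj.
- apply/'forall_forallP => kap1 kap2; apply/implyP => ne; rewrite !ffunE.
  apply/pred0P => s /=; apply/negP => /andP[/imsetP[i1 _ ->] /imsetP[i2 _ e]].
  by move: ne; rewrite -(deg _ _ i1 i2) e eqxx.
- apply/forallP => kap; rewrite ffunE; apply/forall_inP => _ /imsetP[i1 _ ->].
  by apply/forall_inP => _ /imsetP[i2 _ ->]; rewrite deg.
- apply/'forall_forallP => kap1 kap2; apply/implyP => ne; rewrite !ffunE.
  apply/forall_inP => _ /imsetP[i1 _ ->]; apply/forall_inP => _ /imsetP[i2 _ ->].
  by rewrite deg.
Qed.

End Assembly.

Lemma equidegree_family_le (gT : finGroupType) (G : {group gT}) (k l : nat)
    (A : {ffun 'I_k -> {set Iirr G}}) :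
  (0 < l)%N -> equidegree_family l A -> (k <= Nirr G)%N.
Proof.
move=> l0 /and4P[/forallP cA /'forall_forallP dA _ _].
have hA i : {s | s \in A i} by apply/sigW/card_gt0P; rewrite (eqP (cA i)).
rewrite -[k]card_ord -[Nirr G]card_ord; apply: (leq_card (fun i => sval (hA i))) => i j e.
apply/eqP/contraT => ne; have := implyP (dA i j) ne.
by move/disjointFr => /(_ _ (svalP (hA i))); rewrite e (svalP (hA j)).
Qed.

Close Scope ring_scope.

Theorem theorem1p1 :
  (forall k l : nat, 0 < k -> 0 < l ->
     exists N : nat, forall n : nat, N <= n ->
       exists A : {ffun 'I_k -> {set Iirr [set: 'S_n]}},
         equidegree_family (G := [set: 'S_n]%G) l A)
  /\
  (forall l : nat, 0 < l ->
     forall M : nat, exists N : nat, forall n : nat, N <= n ->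
       M <= max_equidegree [set: 'S_n]%G l).
Proof.
split=> [k l k0 _|l l0 M].
  by exists (3 * power_sum k l + 4)%N => n hn; apply: equidegree_exists.
(* [M.+1] classes are built instead of M, so that their number is positive. *)
exists (3 * power_sum M.+1 l + 4)%N => n hn.
have [A hA] := equidegree_exists hn isT.
have hM : (M.+1 < (Nirr [set: 'S_n]%G).+1)%N by rewrite ltnS (equidegree_family_le l0 hA).
have ex_A : [exists A : {ffun 'I_(Ordinal hM) -> {set Iirr [set: 'S_n]%G}}, equidegree_family l A].
  by apply/existsP; exists A.
apply: leq_trans (leqnSn M) _.
exact: (leq_bigmax_cond (F := fun i : 'I_(Nirr [set: 'S_n]%G).+1 => i : nat) (Ordinal hM) ex_A).
Qed.
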